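(* Let $L^*$ be a real symmetric positive definite $N\times N$ matrix and let $Z\sim\mathsf{DPP}(L^* )$. Then the kernel $L$ of any partial decoupling of $Z$ is a critical point of the expected log-likelihood $\Phi_{L^*}$. Moreover, it is always a saddle point of $\Phi_{L^*}$ when the partial decoupling is strict.
   Context: Notation: $[N]=\{1,\dots,N\}$; $\mathcal S_{[N]}^{++}$ is the set of real symmetric positive definite $N\times N$ matrices, an open subset of the space $\mathcal S_{[N]}$ of real symmetric matrices. For a matrix $A$ and $J\subset[N]$, $A_J$ is the principal submatrix indexed by $J$, with $\det A_\emptyset=1$. For $L\in\mathcal S_{[N]}^{++}$, the determinantal point process (DPP) with kernel $L$, $\mathsf{DPP}(L)$, is the law of a random subset $Z\subset[N]$ with $\mathbb P[Z=J]=p_J(L)=\det(L_J)/\det(I+L)$ for all $J\subset[N]$. Its correlation kernel is $K=L(I+L)^{-1}$, and $\mathbb P[J\subset Z]=\det(K_J)$ for all $J\subset [N]$; conversely $L=K(I-K)^{-1}$. Expected log-likelihood: for $L\in\mathcal S_{[N]}^{++}$, $\Phi_{L^*}(L)=\sum_{J\subset[N]}p_J(L^* )\log\det(L_J)-\log\det(I+L)$. A critical point is a point $L\in\mathcal S_{[N]}^{++}$ where the first derivative $\mathrm{d}\Phi_{L^*}(L)$ vanishes on $\mathcal S_{[N]}$; a saddle point is a critical point that is neither a local maximum nor a local minimum. Partial decoupling: given a partition $\mathcal P$ of $[N]$, a partial decoupling $Z'$ of $Z$ according to $\mathcal P$ is a random subset of $[N]$ such that the random sets $Z'\cap J$, $J\in\mathcal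 P$, are mutually independent and $Z'\cap J$ has the same distribution as $Z\cap J$ for every $J\in\mathcal P$. It is strict if $Z'$ does not have the same distribution as $Z$. Such a $Z'$ is again a DPP, with correlation kernel $K'$ given by $K'_{i,j}=K^*_{i,j}$ if $i,j$ belong to the same element of $\mathcal P$ and $K'_{i,j}=0$ otherwise, where $K^*=L^*(I+L^* )^{-1}$; a kernel of $Z'$ is a matrix $L\in\mathcal S_{[N]}^{++}$ with $Z'\sim\mathsf{DPP}(L)$ (it is unique up to replacing $L$ by $DLD$ with $D$ diagonal with $\pm1$ entries). *)

(* Defs.v *)
(* The ground set [N] is 'I_N, and a random subset of [N] is a random variable
   with values in {set 'I_N}. *)
From HB Require Import structures.
From mathcomp Require Import all_boot all_order all_algebra.
From mathcomp Require Import all_classical all_reals all_analysis.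

Set Implicit Arguments.
Unset Strict Implicit.
Unset Printing Implicit Defensive.

Import Order.TTheory GRing.Theory Num.Theory.
Import numFieldNormedType.Exports.

Local Open Scope classical_set_scope.
Local Open Scope ring_scope.

HB.instance Definition _ (I : finType) :=
  isPointed.Build {set I} (@finset.set0 I).
(* Every set of subsets of a finite type is an event. *)
HB.instance Definition _ (I : finType) :=
  @isMeasurable.Build default_measure_display {set I}
    discrete_measurable discrete_measurable0
    discrete_measurableC discrete_measurableU.

Section Kernels.
Context {R : realType} {N : nat}.
Implicit Types (L Lstar H : 'M[R]_N) (J : {set 'I_N}).

Definition sym : set 'M[R]_N := [set H | H \is symmetricmx].

Definition spd : set 'M[R]_N :=
  [set L | sym L /\
    forall v : 'cV[R]_N, v != 0 -> 0 < (v^T *m L *m v) ord0 ord0].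

(* The rows and columns of L indexed by J, listed in increasing order; for
   J = set0 this is the 0 x 0 matrix, whose determinant is 1. *)
Definition principal L J : 'M[R]_#|J| :=
  mxsub (@enum_val _ (mem J)) (@enum_val _ (mem J)) L.

Definition dpp_prob L J : R := \det (principal L J) / \det (1%:M + L).

(* Only meaningful for L in spd, where all the determinants are positive; the
   formula makes it a total function on square matrices. *)
Definition Phi Lstar L : R :=
  \sum_(J : {set 'I_N}) dpp_prob Lstar J * ln (\det (principal L J))
  - ln (\det (1%:M + L)).

(* 'd f L is the differential on the space of all square matrices. Since f is
   required to be differentiable there, the restriction of 'd f L to sym is the
   differential at L of the restriction of f to sym, so it only depends on the
   values of f on the open subset spd of sym. *)
Definition critical_point (f : 'M[R]_N -> R) L : Prop :=
  [/\ spd L, differentiable f L & forall H, sym H -> 'd f L H = 0].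

(* Local extrema are relative to spd, not to the space of all matrices. *)
Definition local_max (f : 'M[R]_N -> R) L : Prop :=
  \forall M \near within spd (nbhs L), f M <= f L.

Definition local_min (f : 'M[R]_N -> R) L : Prop :=
  \forall M \near within spd (nbhs L), f L <= f M.

Definition saddle_point (f : 'M[R]_N -> R) L : Prop :=
  [/\ critical_point f L, ~ local_max f L & ~ local_min f L].

End Kernels.

(* The random variables may live on different probability spaces. *)
Definition same_law (R : realType) (d1 d2 d : measure_display)
    (T1 : measurableType d1) (T2 : measurableType d2) (S : measurableType d)
    (P1 : probability T1 R) (X1 : T1 -> S)
    (P2 : probability T2 R) (X2 : T2 -> S) : Prop :=
  forall A : set S, measurable A -> pushforward P1 X1 A = pushforward P2 X2 A.

Definition mutually_independent (R : realType) (d d' : measure_display)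
    (T : measurableType d) (S : measurableType d') (P : probability T R)
    (I : finType) (A : {set I}) (X : I -> T -> S) : Prop :=
  forall (B : {set I}) (E : I -> set S), B \subset A ->
    (forall i, i \in B -> measurable (E i)) ->
    P (\bigcap_(i in [set` B]) X i @^-1` E i) =
      (\prod_(i in B) P (X i @^-1` E i))%E.

Section RandomSubsets.
Context {R : realType} {N : nat} {d d' : measure_display}.
Context {T : measurableType d} {T' : measurableType d'}.

(* Z ~ DPP(L), i.e. L is a kernel of Z. *)
Definition has_dpp_kernel (P : probability T R) (Z : {RV P >-> {set 'I_N}})
    (L : 'M[R]_N) : Prop :=
  spd L /\ forall J : {set 'I_N}, P (Z @^-1` [set J]) = (dpp_prob L J)%:E.

Definition partial_decoupling (PP : {set {set 'I_N}})
    (P : probability T R) (Z : {RV P >-> {set 'I_N}})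
    (P' : probability T' R) (Z' : {RV P' >-> {set 'I_N}}) : Prop :=
  mutually_independent P' PP (fun J w => Z' w :&: J) /\
  forall J, J \in PP ->
    same_law P' (fun w => Z' w :&: J) P (fun w => Z w :&: J).

Definition strict_partial_decoupling (PP : {set {set 'I_N}})
    (P : probability T R) (Z : {RV P >-> {set 'I_N}})
    (P' : probability T' R) (Z' : {RV P' >-> {set 'I_N}}) : Prop :=
  partial_decoupling PP Z Z' /\ ~ same_law P' Z' P Z.

End RandomSubsets.

(* Main.v *)
(** The independence of the blocks forces the off-block entries of
    [(I + L)^-1] to vanish, since [- ((I + L)^-1)_ij ^ 2] is the covariance of
    the events [i \notin Z'] and [j \notin Z']; so [L] is block diagonal. The
    log-likelihood of a block diagonal kernel only involves the laws of the
    traces on the blocks, so [Phi Lstar] and [Phi L] agree on block diagonal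
    kernels, and by Gibbs' inequality [L] maximizes [Phi Lstar] among them. In
    an off-block direction [u w^T + w u^T], every determinant in
    [Phi Lstar (L + t H)] is an even function of [t]. Hence [L] is critical.

    [L] is not a local minimum because of the block diagonal kernels
    [(1 + t) L]. Suppose that it is a local maximum. In the direction
    [u w^T + w u^T], with [u] and [w] supported in distinct blocks, the second
    order term of [Phi Lstar] is, up to the sign, the covariance under
    [Lstar] of [u^T L_J^-1 u] and [w^T L_J^-1 w], which is therefore
    nonnegative. Writing the blocks of [L] as sums of rank-one matrices and
    summing, the covariance of the numbers of points of [Z] in the two blocks
    is nonnegative as well. But it equals minus the sum of the squares of the
    entries of [(I + Lstar)^-1] between these blocks, so [Lstar] is block
    diagonal, and the equality case of Gibbs' inequality shows that [Z] and
    [Z'] have the same law. *)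
Require Import Defs.
From mathcomp Require Import all_boot all_order all_algebra.
From mathcomp Require Import all_classical all_reals all_analysis.
From mathcomp Require Import perm ring lra.

Set Implicit Arguments.
Unset Strict Implicit.
Unset Printing Implicit Defensive.

Import Order.TTheory GRing.Theory Num.Theory.
Import numFieldNormedType.Exports.

Local Open Scope ring_scope.

(** * Principal minors *)

Section Determinants.
Context {R : comNzRingType}.

(** Sylvester's identity, read off from two block triangular factorizations of one block matrix. *)
Lemma det1D_mulmxC m n (A : 'M[R]_(m, n)) (B : 'M[R]_(n, m)) :
  \det (1%:M + A *m B) = \det (1%:M + B *m A).
Proof.
have e1 : block_mx 1%:M (- A) B 1%:M =
    block_mx 1%:M 0 B 1%:M *m block_mx 1%:M (- A) 0 (1%:M + B *m A).
  by rewrite mulmx_block !(mul0mx, mulmx0, mul1mx, mulmx1, addr0, add0r)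
             mulmxN addrCA addNr addr0.
have e2 : block_mx 1%:M (- A) B 1%:M =
    block_mx (1%:M + A *m B) (- A) 0 1%:M *m block_mx 1%:M 0 B 1%:M.
  by rewrite mulmx_block !(mul0mx, mulmx0, mul1mx, mulmx1, addr0, add0r)
             mulNmx addrK.
have := congr1 determinant e1; rewrite e2 !det_mulmx !det_ublock !det_lblock.
by rewrite !det1 !(mul1r, mulr1).
Qed.

(** Multilinearity in the rows: in the Leibniz formula, distributing each product chooses for every
    row whether it comes from [A] or from [B]. *)
Lemma det_addmx n (A B : 'M[R]_n) :
  \det (A + B) = \sum_(J : {set 'I_n})
    \det (\matrix_(i, j) if i \in J then A i j else B i j).
Proof.
rewrite /determinant exchange_big /=; apply: eq_bigr => s _.
rewrite -mulr_sumr; congr (_ * _).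
under eq_bigr do rewrite mxE.
rewrite bigA_distr; apply: eq_big => [J|J _]; first by rewrite inE.
by apply: eq_bigr => i _; rewrite mxE.
Qed.

End Determinants.

(** * Selection matrices, coordinate projections and void probabilities *)

Section Selection.
Context {R : realType} {N : nat}.
Implicit Types (L M : 'M[R]_N) (J A B : {set 'I_N}).

Definition sel J : 'M[R]_(#|J|, N) := rowsub (@enum_val _ (mem J)) 1%:M.

Definition proj J : 'M[R]_N := diag_mx (\row_i (i \in J)%:R).

Lemma principalE M J : principal M J = sel J *m M *m (sel J)^T.
Proof.
apply/matrixP => i j; rewrite /sel !mxE mul_rowsub_mx mul1mx.
rewrite (bigD1 (enum_val j)) //= !mxE eqxx mulr1 big1 ?addr0 // => k kj.
by rewrite !mxE eq_sym (negbTE kj) mulr0.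
Qed.

Lemma sel_trmx J : sel J *m (sel J)^T = 1%:M.
Proof.
have := principalE 1%:M J; rewrite mulmx1 => <-; apply/matrixP => i j.
by rewrite !mxE (inj_eq enum_val_inj).
Qed.

Lemma trmx_sel J : (sel J)^T *m sel J = proj J.
Proof.
apply/matrixP => i j; rewrite !mxE.
have [iJ|iJ] := boolP (i \in J).
  rewrite (bigD1 (enum_rank_in iJ i)) //= !mxE enum_rankK_in // eqxx mul1r.
  rewrite big1 ?addr0; first by case: eqP.
  move=> k ki; rewrite !mxE; case: eqP => [e|]; last by rewrite mul0r.
  by case/eqP: ki; apply: enum_val_inj; rewrite enum_rankK_in.
rewrite mul0rn big1 // => k _; rewrite !mxE; case: eqP => [e|].
  by move: iJ; rewrite -e enum_valP.
by rewrite mul0r.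
Qed.

Lemma projE J i j : proj J i j = ((i == j) && (i \in J))%:R.
Proof. by rewrite !mxE; case: (i == j); case: (i \in J). Qed.

Lemma proj_mulmxE J n (M : 'M[R]_(N, n)) i j :
  (proj J *m M) i j = (i \in J)%:R * M i j.
Proof. by rewrite mul_diag_mx !mxE. Qed.

Lemma mulmx_projE J n (M : 'M[R]_(n, N)) i j :
  (M *m proj J) i j = M i j * (j \in J)%:R.
Proof. by rewrite mul_mx_diag !mxE. Qed.

Lemma tr_proj J : (proj J)^T = proj J.
Proof. exact: tr_diag_mx. Qed.

Lemma projI A B : proj A *m proj B = proj (A :&: B).
Proof.
apply/matrixP => i j; rewrite proj_mulmxE !projE inE.
by case: (i == j); case: (i \in A); case: (i \in B); rewrite /= ?mulr0 ?mulr1.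
Qed.

Lemma projC A B : proj A *m proj B = proj B *m proj A.
Proof. by rewrite !projI finset.setIC. Qed.

Lemma mxtrace_proj J : \tr (proj J) = #|J|%:R.
Proof.
rewrite mxtrace_diag -sum1_card natr_sum [RHS]big_mkcond /=.
by apply: eq_bigr => i _; rewrite mxE; case: (i \in J).
Qed.

Lemma proj_sel J : proj J *m (sel J)^T = (sel J)^T.
Proof. by rewrite -trmx_sel -mulmxA sel_trmx mulmx1. Qed.

Lemma sel_proj J : sel J *m proj J = sel J.
Proof. by rewrite -trmx_sel mulmxA sel_trmx mul1mx. Qed.

(** By Sylvester's identity a minor of size [#|J|] becomes a determinant of fixed size [N], so
    minors for different [J] can be multiplied and compared. *)
Lemma det_principal M J :
  \det (principal M J) = \det (1%:M + proj J *m (M - 1%:M)).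
Proof.
rewrite -trmx_sel -mulmxA det1D_mulmxC mulmxBr mulmxBl mulmx1 sel_trmx.
by rewrite addrCA subrr addr0 principalE.
Qed.

Lemma proj0 : proj finset.set0 = 0.
Proof. by apply/matrixP => i j; rewrite projE inE andbF mxE. Qed.

Lemma det_principal0 M : \det (principal M finset.set0) = 1.
Proof. by rewrite det_principal proj0 mul0mx addr0 det1. Qed.

Lemma sum_det_principal M :
  \sum_(J : {set 'I_N}) \det (principal M J) = \det (1%:M + M).
Proof.
rewrite addrC det_addmx; apply: eq_bigr => J _; rewrite det_principal.
congr (\det _); apply/matrixP => i j.
rewrite [RHS]mxE [LHS]mxE proj_mulmxE !mxE.
by case: (i \in J); rewrite ?mul0r ?addr0 // mul1r addrCA subrr addr0.
Qed.

(** The right factor kills the columns indexed by [A], so the minor has a zero column as soon as [J]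
    meets [A]. *)
Lemma det_principal_proj M A J :
  \det (principal (M *m proj (~: A)) J) =
  if [disjoint J & A] then \det (principal M J) else 0.
Proof.
case: ifPn => [dJA|].
  congr (\det _); apply/matrixP => i j; rewrite [LHS]mxE [RHS]mxE mulmx_projE inE.
  by rewrite (disjointFr dJA (enum_valP j)) mulr1.
rewrite -setI_eq0 => /set0Pn[i]; rewrite inE => /andP[iJ iA].
rewrite (expand_det_col _ (enum_rank_in iJ i)) big1 // => k _.
by rewrite [X in X * _]mxE mulmx_projE enum_rankK_in // inE iA mulr0 mul0r.
Qed.

Lemma sum_det_principal_disjoint M A :
  \sum_(J : {set 'I_N} | [disjoint J & A]) \det (principal M J) =
  \det (1%:M + M *m proj (~: A)).
Proof.
rewrite -sum_det_principal [LHS]big_mkcond /=.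
by apply: eq_bigr => J _; rewrite det_principal_proj.
Qed.

Lemma projCE A : proj (~: A) = 1%:M - proj A.
Proof.
apply/matrixP => i j; rewrite projE inE [RHS]mxE [X in _ = _ + X]mxE projE mxE.
by case: (i == j); case: (i \in A); rewrite /= ?subr0 ?subrr.
Qed.

(** The matrix [invmx (1%:M + L)] is I - K, the correlation kernel of the complement of the process.
    The sum of minors is a determinant from which [1%:M + L], the normalization, factors out. *)
Lemma sum_dpp_disjoint L A : 1%:M + L \in unitmx ->
  \sum_(J : {set 'I_N} | [disjoint J & A]) dpp_prob L J =
  \det (principal (invmx (1%:M + L)) A).
Proof.
move=> uL; have dL : \det (1%:M + L) != 0 by rewrite -unitfE -unitmxE.
rewrite /dpp_prob -mulr_suml sum_det_principal_disjoint.
have -> : 1%:M + L *m proj (~: A) =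
    (1%:M + L) *m (1%:M + (invmx (1%:M + L) - 1%:M) *m proj A).
  rewrite mulmxDr mulmx1 mulmxA mulmxBr mulmxV // mulmx1.
  by rewrite opprD [1%:M + (_ - _)]addrA subrr sub0r mulNmx projCE mulmxBr mulmx1 addrA.
rewrite det_mulmx mulrAC divff // mul1r det1D_mulmxC.
by rewrite det_principal.
Qed.

End Selection.

(** * Positive definite matrices *)

Section PositiveDefinite.
Context {R : realType}.

Definition bil n (L : 'M[R]_n) (u v : 'cV[R]_n) : R :=
  (u^T *m L *m v) ord0 ord0.

Section Bilinear.
Context {n : nat}.
Implicit Types (L M : 'M[R]_n) (u v w : 'cV[R]_n).

Lemma symP L : sym L <-> L^T = L.
Proof.
rewrite /sym /= is_hermitianmxE expr0 scale1r; split=> [/eqP e|e].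
  by rewrite [RHS]e; apply/matrixP => i j; rewrite !mxE.
by apply/eqP; rewrite -[LHS]e; apply/matrixP => i j; rewrite !mxE.
Qed.

Lemma bilDm L M u v : bil (L + M) u v = bil L u v + bil M u v.
Proof. by rewrite /bil mulmxDr mulmxDl mxE. Qed.

Lemma bilZm a L u v : bil (a *: L) u v = a * bil L u v.
Proof. by rewrite /bil -scalemxAr -scalemxAl mxE. Qed.

Lemma bilDl L u v w : bil L (u + v) w = bil L u w + bil L v w.
Proof. by rewrite /bil linearD /= !mulmxDl mxE. Qed.

Lemma bilZl L a u v : bil L (a *: u) v = a * bil L u v.
Proof. by rewrite /bil linearZ /= -!scalemxAl mxE. Qed.

Lemma bilDr L u v w : bil L u (v + w) = bil L u v + bil L u w.
Proof. by rewrite /bil mulmxDr mxE. Qed.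

Lemma bilZr L a u v : bil L u (a *: v) = a * bil L u v.
Proof. by rewrite /bil -!scalemxAr mxE. Qed.

Lemma bilC L u v : sym L -> bil L u v = bil L v u.
Proof.
move=> /symP sL; rewrite /bil -[in LHS](trmxK (u^T *m L *m v)) mxE.
by rewrite !trmx_mul trmxK sL mulmxA.
Qed.

Lemma bil1C u v : bil 1%:M u v = bil 1%:M v u.
Proof. by apply: bilC; apply/symP; rewrite trmx1. Qed.

Lemma bil_mul L A B u v : bil L (A *m u) (B *m v) = bil (A^T *m L *m B) u v.
Proof. by rewrite /bil trmx_mul !mulmxA. Qed.

Lemma bil_mull L A u v : bil L (A *m u) v = bil (A^T *m L) u v.
Proof. by rewrite /bil trmx_mul !mulmxA. Qed.

Lemma bil_mulr L B u v : bil L u (B *m v) = bil (L *m B) u v.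
Proof. by rewrite /bil !mulmxA. Qed.

Lemma bil_outer u w x y :
  bil (u *m w^T) x y = bil 1%:M x u * bil 1%:M w y.
Proof.
by rewrite /bil !mulmx1 -!mulmxA mulmxA mxE big_ord1.
Qed.

Lemma mxtrace_outer L u v : \tr (L *m (u *m v^T)) = bil L v u.
Proof.
rewrite mulmxA mxtrace_mulC mulmxA /bil /mxtrace big_ord1.
by [].
Qed.

Lemma bil_delta L i j : bil L (delta_mx i 0) (delta_mx j 0) = L i j.
Proof. by rewrite /bil trmx_delta -rowE -colE !mxE. Qed.

Lemma spd_bil_gt0 L v : spd L -> v != 0 -> 0 < bil L v v.
Proof. by case=> _; apply. Qed.

Lemma spd_bil_ge0 L v : spd L -> 0 <= bil L v v.
Proof.
move=> pL; have [->|v0] := eqVneq v 0; first by rewrite /bil mulmx0 mxE.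
exact: ltW (spd_bil_gt0 pL v0).
Qed.

Lemma spd1 : spd (1%:M : 'M[R]_n).
Proof.
split; first by apply/symP; rewrite trmx1.
move=> v v0; rewrite mulmx1 mxE.
have ge0 i : true -> 0 <= v^T ord0 i * v i ord0.
  by move=> _; rewrite mxE -expr2 sqr_ge0.
rewrite lt_neqAle sumr_ge0 // andbT eq_sym psumr_eq0 //.
apply: contraNN v0 => /allP v0; apply/eqP/matrixP => i j.
have := v0 i (mem_index_enum i).
by rewrite mxE mulf_eq0 orbb [j]ord1 => /eqP ->; rewrite mxE.
Qed.

Lemma spdD L M : spd L -> spd M -> spd (L + M).
Proof.
move=> pL pM; case: (pL) (pM) => [/symP sL _] [/symP sM _]; split.
  by apply/symP; rewrite linearD /= sL sM.
move=> v v0; rewrite -/(bil _ _ _) bilDm.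
by rewrite addr_gt0 ?spd_bil_gt0.
Qed.

Lemma spdZ a L : 0 < a -> spd L -> spd (a *: L).
Proof.
move=> a0 pL; case: (pL) => [/symP sL _]; split.
  by apply/symP; rewrite linearZ /= sL.
by move=> v v0; rewrite -/(bil _ _ _) bilZm mulr_gt0 ?spd_bil_gt0.
Qed.

Lemma spd_unitmx L : spd L -> L \in unitmx.
Proof.
move=> pL; rewrite unitmxE unitfE; apply/det0P => -[v v0 vL].
have /(spd_bil_gt0 pL) : v^T != 0 by rewrite -trmx0 (inj_eq trmx_inj).
by rewrite /bil trmxK vL mul0mx mxE ltxx.
Qed.

(** The determinant equals 1 at the identity and cannot vanish on the segment from there to [L],
    which stays positive definite. *)
Lemma spd_det_gt0 L : spd L -> 0 < \det L.
Proof.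
move=> pL.
(* Along the segment the determinant is a polynomial, so the intermediate value theorem for
   polynomials applies. *)
pose q : {poly R} := \det ('X *: map_mx polyC (L - 1%:M) + 1%:M).
have qE t : q.[t] = \det (t *: L + (1 - t) *: 1%:M).
  rewrite -horner_evalE /q -det_map_mx /=; congr (\det _).
  apply/matrixP => i j; rewrite !mxE horner_evalE hornerD hornerM hornerX hornerC.
  by rewrite hornerMn hornerC; ring.
rewrite lt_neqAle eq_sym -unitfE -unitmxE spd_unitmx //= leNgt.
apply/negP => dL.
have := @poly_ivt R (- q) 0 1 ler01.
rewrite !hornerN !qE scale0r subr0 scale1r add0r det1 subrr scale0r addr0 scale1r.
rewrite oppr_cp0 ler01 oppr_ge0 (ltW dL) => /(_ isT)[t /andP[t0 t1]].
rewrite rootN rootE qE => /eqP dt.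
have: spd (t *: L + (1 - t) *: 1%:M).
  have [->|tn0] := eqVneq t 0.
    by rewrite scale0r add0r subr0 scale1r; exact: spd1.
  have [->|tn1] := eqVneq t 1.
    by rewrite subrr scale0r addr0 scale1r.
  by apply: spdD; apply: spdZ => //; [rewrite lt_def tn0|
    rewrite subr_gt0 lt_neqAle tn1|exact: spd1].
by move=> /spd_unitmx; rewrite unitmxE dt unitr0.
Qed.

Lemma sym_invmx L : sym L -> sym (invmx L).
Proof. by move=> /symP sL; apply/symP; rewrite trmx_inv sL. Qed.

Lemma bil_invmx_ge0 L v : spd L -> 0 <= bil (invmx L) v v.
Proof.
move=> pL; rewrite -[v](mulKVmx (spd_unitmx pL)) bil_mul (iffLR (symP L) pL.1).
by rewrite mulmxV ?spd_unitmx // mul1mx spd_bil_ge0.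
Qed.

Lemma bil_Cauchy_Schwarz L u v : spd L ->
  bil L u v ^+ 2 <= bil L u u * bil L v v.
Proof.
move=> pL; have [->|v0] := eqVneq v 0.
  by rewrite /bil !mulmx0 mxE expr0n mulr0.
have vv := spd_bil_gt0 pL v0; set b := bil L v v in vv *.
have := spd_bil_ge0 (u + (- bil L u v / b) *: v) pL.
rewrite bilDl !bilDr !bilZl !bilZr (bilC v u pL.1) -/b.
set c := bil L u v; set a := bil L u u => h.
suff: 0 <= a - c ^+ 2 / b.
  by rewrite subr_ge0 ler_pdivrMr // mulrC.
by rewrite (le_trans h) // le_eqVlt; apply/orP/or_introl/eqP; field; rewrite gt_eqF.
Qed.

(** Cauchy-Schwarz for [L], applied to [x] and [invmx L *m u], bounds the scalar product of [x] and
    [u] by the form of [L] at [x]. This gives an explicit radius of positivity. *)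
Lemma spd_perturb L u w t : spd L ->
    `|t| * (bil (invmx L) u u + bil (invmx L) w w) < 1 ->
  spd (L + t *: (u *m w^T + w *m u^T)).
Proof.
move=> pL ht; have uL := spd_unitmx pL; split.
  apply/symP; rewrite linearD linearZ /= linearD /= !trmx_mul !trmxK.
  by rewrite (iffLR (symP L) pL.1) [w *m _ + _]addrC.
move=> x x0; rewrite -/(bil _ _ _) bilDm bilZm bilDm !bil_outer.
have bL y : bil 1%:M x y ^+ 2 <= bil L x x * bil (invmx L) y y.
  have -> : bil 1%:M x y = bil L x (invmx L *m y) by rewrite bil_mulr mulmxV.
  apply: le_trans (bil_Cauchy_Schwarz _ _ pL) _.
  by rewrite bil_mul mulmxK // (iffLR (symP _) (sym_invmx pL.1)).
move: (bL u) (bL w) ht (spd_bil_gt0 pL x0).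
rewrite !(bil1C _ x).
set a := bil _ x u; set b := bil _ x w; set l := bil L x x.
set al := bil _ u u; set be := bil _ w w => au bw ht l0.
have ab : `|a * b + b * a| <= l * (al + be).
  have := sqr_ge0 (a - b); have := sqr_ge0 (a + b); rewrite sqrrD sqrrB => h1 h2.
  by rewrite mulrDr ler_norml; apply/andP; split; lra.
have : `|t * (a * b + b * a)| < l.
  rewrite normrM (le_lt_trans (ler_wpM2l (normr_ge0 t) ab)) //.
  by rewrite mulrCA -[ltRHS]mulr1 ltr_pM2l.
by rewrite ltr_norml => /andP[h _]; rewrite -ltrBlDl sub0r.
Qed.

End Bilinear.

Lemma spd_principal N (L : 'M[R]_N) J : spd L -> spd (principal L J).
Proof.
move=> pL; rewrite principalE; split.
  by apply/symP; rewrite !trmx_mul trmxK (iffLR (symP L) pL.1) mulmxA.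
move=> v v0; rewrite !mulmxA -mulmxA.
have -> : v^T *m sel J *m L *m ((sel J)^T *m v) =
    ((sel J)^T *m v)^T *m L *m ((sel J)^T *m v) by rewrite trmx_mul trmxK.
apply: pL.2; apply: contraNneq v0 => e.
by rewrite -[v]mul1mx -(sel_trmx J) -mulmxA e mulmx0.
Qed.

Lemma det_principal_gt0 N (L : 'M[R]_N) J : spd L -> 0 < \det (principal L J).
Proof. by move=> pL; apply/spd_det_gt0/spd_principal. Qed.

(** * From rank-one matrices to positive definite ones *)

Section RankOneDecomposition.
Context {n : nat}.

(* Symmetric Gaussian elimination: subtracting the rank-one matrix
   [L e_i e_i^T L / L_ii] leaves a matrix that is positive definite on one
   coordinate fewer. *)
Lemma spd_additive_ge0_on (F : 'M[R]_n -> R) (S : {set 'I_n}) (L : 'M[R]_n) :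
    {morph F : A B / A + B} -> (forall u : 'cV_n, 0 <= F (u *m u^T)) ->
    L^T = L -> proj S *m L = L ->
    (forall v, v != 0 -> proj S *m v = v -> 0 < bil L v v) ->
  0 <= F L.
Proof.
move=> FD F1; have F0 : F 0 = 0.
  by apply: (addrI (F 0)); rewrite -FD !addr0.
elim: {S}_.+1 {-2}S (ltnSn #|S|) L => // k IH S kS L sL SL posL.
have [S0|[i iS]] := set_0Vmem S.
  suff -> : L = 0 by rewrite F0.
  by apply/matrixP => i j; rewrite -SL proj_mulmxE S0 inE mul0r mxE.
pose e : 'cV[R]_n := delta_mx i 0.
have projSe (T : {set 'I_n}) : proj T *m e = (i \in T)%:R *: e.
  apply/matrixP => j l; rewrite proj_mulmxE !mxE.
  by have [->|] := eqVneq j i; rewrite ?andbF // !mulr0.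
have e0 : e != 0.
  by apply/negP => /eqP/matrixP/(_ i 0); rewrite !mxE !eqxx => /eqP; rewrite oner_eq0.
have d0 : 0 < L i i.
  by rewrite -bil_delta; apply: posL => //; rewrite projSe iS scale1r.
pose u := (Num.sqrt (L i i))^-1 *: (L *m e).
have uuE : u *m u^T = (L i i)^-1 *: (L *m e *m (L *m e)^T).
  rewrite /u linearZ /= -scalemxAl -scalemxAr scalerA -invfM -expr2.
  by rewrite sqr_sqrtr // ltW.
rewrite -[L](subrK (u *m u^T)) FD addr_ge0 //.
have LE : L *m e = col i L by rewrite colE.
have L'E j l : (L - u *m u^T) j l = L j l - (L i i)^-1 * (L j i * L i l).
  rewrite uuE !mxE big_ord1 LE !mxE; congr (_ - _ * (_ * _)).
  by rewrite -[in LHS]sL mxE.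
apply: (IH (S :\ i)).
- by move: kS; rewrite (cardsD1 i) iS.
- by rewrite linearB /= trmx_mul trmxK sL.
- apply/matrixP => j l; rewrite proj_mulmxE !inE L'E.
  have [->|ji] /= := eqVneq j i.
    by rewrite mul0r mulrA mulVf ?gt_eqF // mul1r subrr.
  have [jS|jS] := boolP (j \in S); first by rewrite mul1r.
  by rewrite -SL !proj_mulmxE (negbTE jS) !mul0r mulr0 subr0.
- move=> v v0 Sv; rewrite bilDm -scaleN1r bilZm bil_outer bil1C.
  have -> : bil 1%:M u v = (Num.sqrt (L i i))^-1 * bil L e v.
    by rewrite bilZl bil_mull sL mulmx1.
  have projSv : proj S *m v = v.
    rewrite -[in LHS]Sv mulmxA projI.
    by rewrite (finset.setIidPr _) ?Sv // subD1set.
  (* This [c] minimizes the form of [L] on the line through [v] directed by [e]; the minimum is the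
     form of the Schur complement at [v]. *)
  pose c := - bil L e v / L i i.
  have := posL (v + c *: e).
  rewrite mulmxDr projSv -scalemxAr projSe iS scale1r => /(_ _ erefl) pos.
  have : 0 < bil L (v + c *: e) (v + c *: e).
    apply: pos; apply: contraNneq v0 => vce.
    (* Removing the coordinate [i] kills [e] and fixes [v], so the vector can vanish only if [v]
       does. *)
    have := congr1 (mulmx (proj (S :\ i))) vce.
    by rewrite mulmx0 mulmxDr Sv -scalemxAr projSe !inE eqxx scale0r scaler0 addr0 => ->.
  rewrite bilDl !bilDr !bilZl !bilZr (bilC v e); last exact/symP.
  rewrite [bil L e e]bil_delta => /lt_le_trans; apply; rewrite le_eqVlt.
  have -> : (Num.sqrt (L i i))^-1 * bil L e v * ((Num.sqrt (L i i))^-1 * bil L e v) =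
      (L i i)^-1 * bil L e v ^+ 2.
    by rewrite -expr2 exprMn exprVn sqr_sqrtr ?ltW.
  by apply/orP/or_introl/eqP; rewrite /c; field; rewrite gt_eqF.
Qed.

Lemma spd_additive_ge0 (F : 'M[R]_n -> R) (L : 'M[R]_n) :
    {morph F : A B / A + B} -> (forall u : 'cV_n, 0 <= F (u *m u^T)) ->
  spd L -> 0 <= F L.
Proof.
move=> FD F1 pL; apply: (@spd_additive_ge0_on F [set: 'I_n]) => //.
- exact/symP/pL.1.
- by apply/matrixP => i j; rewrite proj_mulmxE inE mul1r.
- by move=> v v0 _; exact: spd_bil_gt0.
Qed.

End RankOneDecomposition.

End PositiveDefinite.

(** * Block diagonal kernels *)

Section RankUpdates.
Context {R : realType}.

Lemma det_block1 m n (A : 'M[R]_(m, n)) (B : 'M[R]_(n, m)) :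
  \det (block_mx 1%:M A B 1%:M) = \det (1%:M - B *m A).
Proof.
have -> : block_mx 1%:M A B 1%:M =
    block_mx 1%:M 0 B 1%:M *m block_mx 1%:M A 0 (1%:M - B *m A).
  by rewrite mulmx_block !(mul0mx, mulmx0, mul1mx, mulmx1, addr0, add0r)
             addrCA subrr addr0.
by rewrite det_mulmx det_ublock det_lblock !det1 !mul1r.
Qed.

Lemma det_rank1_update n (M : 'M[R]_n) (u v : 'cV_n) : M \in unitmx ->
  \det (M + u *m v^T) = \det M * (1 + bil (invmx M) v u).
Proof.
move=> uM; have -> : M + u *m v^T = M *m (1%:M + (invmx M *m u) *m v^T).
  by rewrite mulmxDr mulmx1 -!mulmxA mulKVmx.
by rewrite det_mulmx det1D_mulmxC det_mx11 mulmxA /bil !mxE eqxx.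
Qed.

(** The perturbation factors through dimension 2, so Sylvester's identity leaves a 2 x 2
    determinant. The two vanishing cross terms make its diagonal entries 1, and only [t ^+ 2]
    survives. *)
Lemma det_rank2_update n (M : 'M[R]_n) (u w : 'cV_n) t : M \in unitmx ->
    bil (invmx M) u w = 0 -> bil (invmx M) w u = 0 ->
  \det (M + t *: (u *m w^T + w *m u^T)) =
  \det M * (1 - t ^+ 2 * (bil (invmx M) u u * bil (invmx M) w w)).
Proof.
move=> uM uw wu.
have -> : M + t *: (u *m w^T + w *m u^T) =
    M *m (1%:M + row_mx (t *: (invmx M *m u)) (t *: (invmx M *m w))
                 *m col_mx w^T u^T).
  rewrite mulmxDr mulmx1 mul_row_col mulmxDr -!scalemxAl -!scalemxAr -scalerDr.
  by rewrite -!mulmxA !mulKVmx.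
rewrite det_mulmx det1D_mulmxC mul_col_row -!scalemxAr !mulmxA.
have E (x y : 'cV[R]_n) : x^T *m invmx M *m y = (bil (invmx M) x y)%:M.
  by rewrite [LHS]mx11_scalar.
rewrite !E uw wu raddf0 scaler0 (scalar_mx_block 1 1 (1 : R)) add_block_mx.
rewrite !addr0 !add0r det_block1 -scalemxAl -scalemxAr scalerA -expr2.
rewrite -scalar_mxM det_mx11 !mxE eqxx.
by rewrite !mulr1n.
Qed.

End RankUpdates.

Section Blocks.
Context {R : realType} {N : nat} {K : eqType}.
Variable c : 'I_N -> K.
Implicit Types (L M : 'M[R]_N) (J A B : {set 'I_N}) (u v w : 'cV[R]_N) (k : K).

(** A partition is encoded by the labelling [c]; a label that [c] does not take has an empty
    block. *)
Definition block k : {set 'I_N} := [set i | c i == k].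

Definition block_diagonal M : Prop := forall i j, c i != c j -> M i j = 0.

Lemma proj_blockC M k : block_diagonal M ->
  proj (block k) *m M = M *m proj (block k).
Proof.
move=> bM; apply/matrixP => i j; rewrite proj_mulmxE mulmx_projE !inE mulrC.
have [e|ne] := eqVneq (c i) (c j); first by rewrite e.
by rewrite bM ?mul0r.
Qed.

(** Block diagonality as commutation with the block projections, a form that passes directly to
    inverses. *)
Lemma block_diagonalP M :
  (forall k, proj (block k) *m M = M *m proj (block k)) -> block_diagonal M.
Proof.
move=> h i j ne; have := congr1 (fun X : 'M[R]_N => X i j) (h (c i)).
rewrite /= proj_mulmxE mulmx_projE !inE eqxx mul1r => ->.
by rewrite eq_sym (negbTE ne) mulr0.
Qed.

Lemma invmx_commute n (M E : 'M[R]_n) : M \in unitmx ->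
  E *m M = M *m E -> E *m invmx M = invmx M *m E.
Proof.
move=> uM h; by rewrite -[LHS](mulKmx uM) [M *m _]mulmxA -h -mulmxA mulmxV // mulmx1.
Qed.

Lemma block_diagonal_invmx M : M \in unitmx ->
  block_diagonal M -> block_diagonal (invmx M).
Proof.
by move=> uM bM; apply: block_diagonalP => k; apply/invmx_commute/proj_blockC.
Qed.

Lemma block_diagonal1 : block_diagonal (1%:M : 'M[R]_N).
Proof. by move=> i j; rewrite mxE; case: (eqVneq i j) => [->|//]; rewrite eqxx. Qed.

Lemma block_diagonalD L M :
  block_diagonal L -> block_diagonal M -> block_diagonal (L + M).
Proof. by move=> bL bM i j ne; rewrite mxE bL ?bM ?addr0. Qed.

Lemma block_diagonalZ a M : block_diagonal M -> block_diagonal (a *: M).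
Proof. by move=> bM i j ne; rewrite mxE bM ?mulr0. Qed.

Lemma block_diagonal_outer k u w :
    proj (block k) *m u = u -> proj (block k) *m w = w ->
  block_diagonal (u *m w^T).
Proof.
move=> uk wk i j; rewrite !mxE big_ord1 mxE -uk -wk !proj_mulmxE !inE.
have [<-|] := eqVneq (c i) k; last by rewrite !mul0r.
by rewrite eq_sym => /negbTE ->; rewrite mul0r mulr0.
Qed.

(** In the form of [det_principal], multiplying the two matrices produces the sum of the two
    corrections and one cross term, which vanishes; no reordering of the indices is involved. *)
Lemma det_principalU M A B : [disjoint A & B] ->
    (forall i j, i \in A -> j \in B -> M i j = 0) ->
  \det (principal M (A :|: B)) = \det (principal M A) * \det (principal M B).
Proof.
move=> dAB MAB; rewrite !det_principal -det_mulmx; congr (\det _).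
rewrite mulmxDl mul1mx [_ *m (1%:M + _)]mulmxDr mulmx1 [_ *m (proj B *m _)]mulmxA.
have -> : proj A *m (M - 1%:M) *m proj B = 0.
  apply/matrixP => i j; rewrite mulmx_projE proj_mulmxE !mxE.
  have [iA|] := boolP (i \in A); last by rewrite !mul0r.
  have [jB|] := boolP (j \in B); last by rewrite mulr0.
  rewrite MAB //; case: eqP => [ij|]; last by rewrite mulr0n subr0 mulr0 mul0r.
  by rewrite ij (disjointFl dAB jB) in iA.
rewrite mul0mx addr0 -addrA [proj B *m _ + _]addrC -mulmxDl; congr (_ + _ *m _).
apply/matrixP => i j; rewrite [RHS]mxE !projE inE.
have [iA|iA] := boolP (i \in A); rewrite ?andbF ?addr0 ?add0r //.
by rewrite (disjointFr dAB iA) andbF addr0.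
Qed.

Lemma det_principal_block M J k : block_diagonal M ->
  \det (principal M J) =
  \det (principal M (J :&: block k)) * \det (principal M (J :\: block k)).
Proof.
move=> bM; rewrite -det_principalU ?finset.setID //.
  by rewrite finset.disjoints_subset; apply/fintype.subsetP => i; rewrite !inE => /andP[_ ->].
move=> i j; rewrite !inE => /andP[_ /eqP ik] /andP[jk _].
by apply: bM; rewrite ik eq_sym.
Qed.

Lemma ln_det_principal_seq M J (s : seq K) : spd M -> block_diagonal M ->
    uniq s -> (forall i, i \in J -> c i \in s) ->
  ln (\det (principal M J)) =
  \sum_(k <- s) ln (\det (principal M (J :&: block k))).
Proof.
move=> pM bM; elim: s J => [|k s IH] J /=.
  move=> _ h; have -> : J = finset.set0.
    by apply/finset.setP => i; rewrite inE; apply/negP => /h.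
  by rewrite det_principal0 ln1 big_nil.
move=> /andP[ks us] h; rewrite big_cons (det_principal_block _ k) //.
rewrite lnM ?posrE ?det_principal_gt0 //; congr (_ + _).
rewrite IH //; last first.
  by move=> i; rewrite !inE => /andP[ik /h]; rewrite inE (negbTE ik).
rewrite [LHS]big_seq [RHS]big_seq; apply: eq_bigr => l ls.
(* Since [l] is in [s] and [k] is not, removing block [k] from [J] does not change its trace on
   block [l]. *)
congr (ln (\det (principal M _))); apply/finset.setP => i; rewrite !inE.
have [e|] := eqVneq (c i) l; last by rewrite !andbF.
by rewrite e; have [e'|] := eqVneq l k; [rewrite -e' ls in ks|rewrite !andbT].
Qed.

(* The inverse of the submatrix [L_J], padded with zeros outside [J]. *)
Definition pinv L J : 'M[R]_N :=
  (sel J)^T *m invmx (principal L J) *m sel J.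

Lemma bil_pinv L J u w :
  bil (invmx (principal L J)) (sel J *m u) (sel J *m w) = bil (pinv L J) u w.
Proof. by rewrite /bil /pinv trmx_mul !mulmxA. Qed.

Lemma principal_outer L J u w t :
  principal (L + t *: (u *m w^T + w *m u^T)) J =
  principal L J + t *: (sel J *m u *m (sel J *m w)^T
                        + sel J *m w *m (sel J *m u)^T).
Proof.
rewrite !principalE mulmxDr mulmxDl -scalemxAr -scalemxAl mulmxDr mulmxDl.
by rewrite !trmx_mul !mulmxA.
Qed.

Lemma det_principal_rank1 L J u : spd L ->
  \det (principal (L + u *m u^T) J) =
  \det (principal L J) * (1 + bil (pinv L J) u u).
Proof.
move=> pL; have uP := spd_unitmx (spd_principal J pL).
rewrite -bil_pinv -det_rank1_update //.
by rewrite !principalE mulmxDr mulmxDl trmx_mul !mulmxA.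
Qed.

(** The block projection compressed to [J], called [F] below, commutes with the submatrix of [L],
    hence with its inverse. *)
Lemma proj_block_pinv L J k : spd L -> block_diagonal L ->
  proj (block k) *m pinv L J = pinv L J *m proj (block k).
Proof.
move=> pL bL; set E := proj _.
have [F ES FT] : exists2 F, sel J *m E = F *m sel J & E *m (sel J)^T = (sel J)^T *m F.
  exists (sel J *m E *m (sel J)^T).
    by rewrite -mulmxA trmx_sel -mulmxA projC mulmxA sel_proj.
  by rewrite !mulmxA trmx_sel projC -mulmxA proj_sel.
have FL : F *m principal L J = principal L J *m F.
  rewrite principalE !mulmxA -ES -[RHS]mulmxA -FT.
  by rewrite -[sel J *m E *m L]mulmxA (proj_blockC _ bL) !mulmxA.
have FI := invmx_commute (spd_unitmx (spd_principal J pL)) FL.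
rewrite /pinv [in LHS]mulmxA [in LHS]mulmxA FT -[_ *m F *m _]mulmxA FI.
by rewrite -!mulmxA ES.
Qed.

Lemma block_diagonal_pinv L J : spd L -> block_diagonal L ->
  block_diagonal (pinv L J).
Proof. by move=> pL bL; apply: block_diagonalP => k; exact: proj_block_pinv. Qed.

Lemma bil_cross M k l u w : block_diagonal M -> k != l ->
    proj (block k) *m u = u -> proj (block l) *m w = w ->
  bil M u w = 0.
Proof.
move=> bM kl <- <-; rewrite bil_mul tr_proj proj_blockC //.
rewrite -mulmxA projI; have -> : block k :&: block l = finset.set0.
  apply/finset.setP => i; rewrite !inE; apply/negP => /andP[/eqP-> /eqP e].
  by rewrite e eqxx in kl.
by rewrite proj0 mulmx0 /bil mulmx0 mul0mx mxE.
Qed.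

(** By cyclicity of the trace the submatrix of [L] cancels its inverse, leaving the trace of a
    projection. This turns quadratic forms into numbers of points. *)
Lemma mxtrace_pinv L J k : spd L -> block_diagonal L ->
  \tr (pinv L J *m (proj (block k) *m L *m proj (block k))) =
  #|J :&: block k|%:R.
Proof.
move=> pL bL; have -> : proj (block k) *m L *m proj (block k) = proj (block k) *m L.
  by rewrite -mulmxA -proj_blockC // mulmxA projI finset.setIid.
have -> : pinv L J *m (proj (block k) *m L) = (sel J)^T *m (invmx (principal L J)
    *m (sel J *m proj (block k) *m (sel J)^T) *m (sel J *m L)).
  rewrite /pinv -!mulmxA; congr (_ *m (_ *m _)).
  by rewrite [(sel J)^T *m _]mulmxA trmx_sel !mulmxA -[sel J *m _ *m proj J]mulmxA
    projC mulmxA sel_proj.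
set F := sel J *m proj _ *m _.
rewrite mxtrace_mulC -[_ *m (sel J *m L) *m _]mulmxA -principalE.
rewrite -[invmx _ *m F *m _]mulmxA mxtrace_mulC -[F *m _ *m _]mulmxA.
rewrite mulmxV ?(spd_unitmx (spd_principal J pL)) // mulmx1.
by rewrite /F mxtrace_mulC mulmxA trmx_sel projI mxtrace_proj.
Qed.

(** The update [L + u *m u^T] is still block diagonal and changes only block [k]. Factoring its
    minor on [J] and cancelling the unchanged factor shows that the form sees only the trace of [J]
    on that block. *)
Lemma bil_pinv_block L J k u : spd L -> block_diagonal L ->
    proj (block k) *m u = u ->
  bil (pinv L J) u u = bil (pinv L (J :&: block k)) u u.
Proof.
move=> pL bL uk; set M := L + u *m u^T.
have bM : block_diagonal M := block_diagonalD bL (block_diagonal_outer uk uk).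
have JkJ : (J :&: block k) :&: block k = J :&: block k.
  by rewrite -finset.setIA finset.setIid.
have ME : principal M (J :\: block k) = principal L (J :\: block k).
  apply/matrixP => i j; rewrite !mxE big_ord1.
  have := enum_valP i; rewrite inE => /andP[/negbTE ni _].
  have -> : u (enum_val i) 0 = 0 by rewrite -uk proj_mulmxE ni mul0r.
  by rewrite mul0r addr0.
have := det_principal_rank1 J u pL; rewrite -/M.
rewrite (det_principal_block J k bM) (det_principal_block J k bL) ME.
rewrite det_principal_rank1 // mulrAC => /mulfI.
rewrite mulf_neq0 ?gt_eqF ?det_principal_gt0 // => /(_ isT) /(congr1 (fun x => x - 1)).
by rewrite ![1 + _]addrC !addrK.
Qed.

End Blocks.

(** * The expected log-likelihood *)

Section Likelihood.
Context {R : realType} {N : nat}.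
Implicit Types (L M Lstar : 'M[R]_N) (J : {set 'I_N}).

Lemma spd1D L : spd L -> spd (1%:M + L).
Proof. by move=> pL; apply: spdD => //; exact: spd1. Qed.

Lemma dpp_prob_gt0 L J : spd L -> 0 < dpp_prob L J.
Proof.
by move=> pL; rewrite divr_gt0 ?det_principal_gt0 ?spd_det_gt0 //; exact: spd1D.
Qed.

Lemma sum_dpp_prob L : spd L -> \sum_J dpp_prob L J = 1.
Proof.
move=> pL; rewrite /dpp_prob -mulr_suml sum_det_principal divff //.
by rewrite gt_eqF // spd_det_gt0 //; exact: spd1D.
Qed.

(** Compare two expansions of the determinant of [1%:M + L + u *m u^T]: as a sum of principal
    minors, and as a rank-one update. *)
Lemma sum_dpp_pinv L (u : 'cV[R]_N) : spd L ->
  \sum_J dpp_prob L J * bil (pinv L J) u u = bil (invmx (1%:M + L)) u u.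
Proof.
move=> pL; have p1L := spd1D pL; have d0 := spd_det_gt0 p1L.
have := sum_det_principal (L + u *m u^T); rewrite addrA.
rewrite det_rank1_update ?spd_unitmx //.
under eq_bigr => J _ do rewrite det_principal_rank1 // mulrDr mulr1.
rewrite big_split /= sum_det_principal mulrDr mulr1 => /addrI h.
apply: (mulfI (lt0r_neq0 d0)); rewrite -h mulr_sumr; apply: eq_bigr => J _.
by rewrite /dpp_prob; field; rewrite lt0r_neq0.
Qed.

(** Up to sign, the log-likelihood is a cross-entropy; the normalization enters the sum because the
    weights add up to 1. *)
Lemma PhiE Lstar M : spd Lstar -> spd M ->
  Phi Lstar M = \sum_J dpp_prob Lstar J * ln (dpp_prob M J).
Proof.
move=> pS pM; have d0 := spd_det_gt0 (spd1D pM).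
have -> : Phi Lstar M = \sum_J dpp_prob Lstar J * ln (\det (principal M J)) -
    \sum_J dpp_prob Lstar J * ln (\det (1%:M + M)).
  by rewrite -mulr_suml (sum_dpp_prob pS) mul1r.
rewrite -sumrB.
apply: eq_bigr => J _; rewrite -mulrBr [dpp_prob M J]/dpp_prob ln_div ?posrE //.
exact: det_principal_gt0.
Qed.

Lemma ln_le_subr1 (x : R) : 0 < x -> ln x <= x - 1.
Proof. by move=> x0; have := expR_ge1Dx (ln x); rewrite lnK ?posrE // lerBrDl. Qed.

Lemma ln_eq_subr1 (x : R) : 0 < x -> ln x = x - 1 -> x = 1.
Proof.
move=> x0 e; have [l0|/expR_gt1Dx] := eqVneq (ln x) 0.
  by apply/eqP; rewrite -subr_eq0 -e l0.
by rewrite lnK ?posrE // e addrC subrK ltxx.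
Qed.

(** The bound [ln x <= x - 1] at the inverse of [1 - z]. Its explicit quadratic error stands in for
    a Taylor expansion in [local_max_cross]. *)
Lemma ln1B_ge (z : R) : 0 <= z <= 1 / 2 -> - z - 2 * z ^+ 2 <= ln (1 - z).
Proof.
move=> /andP[z0 z1]; have h0 : 0 < 1 - z by lra.
have := ln_le_subr1 (_ : 0 < (1 - z)^-1); rewrite invr_gt0 lnV ?posrE // => /(_ h0).
suff : (1 - z)^-1 - 1 <= z + 2 * z ^+ 2 by lra.
rewrite lerBlDr -[(1 - z)^-1]mul1r ler_pdivrMr //.
have : 0 <= z ^+ 2 * (1 - 2 * z) by rewrite mulr_ge0 ?sqr_ge0 //; lra.
have -> : z ^+ 2 * (1 - 2 * z) = (z + 2 * z ^+ 2 + 1) * (1 - z) - 1 by ring.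
by rewrite subr_ge0.
Qed.

(** A relative entropy with nonnegative terms: the added quantities ratio minus 1 have mean zero,
    both laws having total mass 1. *)
Lemma PhiB L M : spd L -> spd M ->
  Phi L L - Phi L M = \sum_J dpp_prob L J *
    (dpp_prob M J / dpp_prob L J - 1 - ln (dpp_prob M J / dpp_prob L J)).
Proof.
move=> pL pM; rewrite !PhiE // -sumrB.
under [RHS]eq_bigr => J _.
  rewrite mulrBr mulrBr mulr1 mulrC divfK ?lt0r_neq0 ?dpp_prob_gt0 //.
  rewrite ln_div ?posrE ?dpp_prob_gt0 // mulrBr opprB.
  over.
by rewrite [RHS]big_split /= [in RHS]sumrB !sum_dpp_prob // subrr add0r.
Qed.

Lemma Gibbs_term_ge0 L M J : spd L -> spd M -> 0 <= dpp_prob L J *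
    (dpp_prob M J / dpp_prob L J - 1 - ln (dpp_prob M J / dpp_prob L J)).
Proof.
move=> pL pM; rewrite mulr_ge0 ?(ltW (dpp_prob_gt0 _ _)) // subr_ge0.
by rewrite ln_le_subr1 // divr_gt0 ?dpp_prob_gt0.
Qed.

Lemma Phi_le L M : spd L -> spd M -> Phi L M <= Phi L L.
Proof.
by move=> pL pM; rewrite -subr_ge0 PhiB // sumr_ge0 // => J _; exact: Gibbs_term_ge0.
Qed.

Lemma Phi_eq L M : spd L -> spd M -> Phi L M = Phi L L ->
  forall J, dpp_prob M J = dpp_prob L J.
Proof.
move=> pL pM e J; have := PhiB pL pM; rewrite e subrr => /esym/eqP.
rewrite psumr_eq0; last by move=> ? _; exact: Gibbs_term_ge0.
move=> /allP/(_ J (mem_index_enum J)) /=.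
have p0 := dpp_prob_gt0 J pL; rewrite mulf_eq0 gt_eqF //= subr_eq0 eq_sym.
move=> /eqP/ln_eq_subr1 h; apply: divr1_eq; apply: h.
by rewrite divr_gt0 ?dpp_prob_gt0.
Qed.

Lemma differentiable_det (V : normedModType R) n (F : V -> 'M[R]_n) x :
    (forall i j, differentiable (fun y => F y i j) x) ->
  differentiable (fun y => \det (F y)) x.
Proof.
move=> dF; rewrite /determinant.
have -> : (fun y => \sum_(s : 'S_n) (-1) ^+ s * \prod_i F y i (s i)) =
    \sum_(s : 'S_n) ((-1) ^+ s *: (\prod_(i < n) (fun y => F y i (s i)))).
  apply/funext => y; rewrite fct_sumE; apply: eq_bigr => s _.
  by rewrite -[RHS]/(_ * _) fct_prodE.
elim/big_ind : _ => [|f g df dg|s _].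
- exact: differentiable_cst.
- exact: differentiableD.
apply: differentiableZ; elim/big_ind : _ => [|f g df dg|i _].
- exact: differentiable_cst.
- exact: differentiableM.
exact: dF.
Qed.

Lemma differentiable_ln_det n (F : 'M[R]_N -> 'M[R]_n) L :
    (forall i j, differentiable (fun M => F M i j) L) -> 0 < \det (F L) ->
  differentiable (fun M => ln (\det (F M))) L.
Proof.
move=> dF d0; have := @differentiable_comp _ _ _ _ (fun M => \det (F M)) (@ln R) L; apply.
  exact: differentiable_det.
by apply/derivable1_diffP; apply: ex_derive; exact: is_derive1_ln.
Qed.

Lemma differentiable_Phi Lstar L : spd L -> differentiable (Phi Lstar) L.
Proof.
move=> pL.
have -> : Phi Lstar = (\sum_(J : {set 'I_N})
      (dpp_prob Lstar J *: (fun M => ln (\det (principal M J)))))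
    - (fun M => ln (\det (1%:M + M))).
  apply/funext => M; rewrite /Phi.
  by rewrite -[RHS]/((\sum_(J : {set 'I_N}) _) M + _ M) fct_sumE.
apply: differentiableB.
  elim/big_ind : _ => [|f g df dg|J _].
  - exact: differentiable_cst.
  - exact: differentiableD.
  apply: differentiableZ; apply: differentiable_ln_det.
    move=> i j; rewrite (_ : (fun M : 'M[R]_N => _) =
      (fun M : 'M[R]_N => M (enum_val i) (enum_val j))).
      exact: differentiable_coord.
    by apply/funext => M; rewrite mxE.
  exact: det_principal_gt0.
apply: differentiable_ln_det; last by apply/spd_det_gt0/spd1D.
move=> i j; rewrite (_ : (fun M : 'M[R]_N => _) =
    (cst ((1%:M : 'M[R]_N) i j) + (fun M : 'M[R]_N => M i j : R))).
  apply: differentiableD; first exact: differentiable_cst.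
  exact: differentiable_coord.
by apply/funext => M; rewrite mxE.
Qed.

End Likelihood.

(** * Differentials along rays *)

Section DirectionalDerivatives.
Context {R : realType} {V : normedModType R}.
Implicit Types (f : V -> R) (x v : V).
Local Open Scope classical_set_scope.

Lemma near_ray x v (Q : set V) : (\forall y \near x, Q y) ->
  exists2 e : R, 0 < e & forall t, `|t| < e -> Q (x + t *: v).
Proof.
move=> Qx.
have /(_ _ Qx) : (fun t : R => x + t *: v) @ (0 : R) --> x.
  rewrite -[X in _ --> X]addr0 -[X in _ --> _ + X](scale0r v).
  by apply: cvgD; [exact: cvg_cst|apply: cvgZ; [exact: cvg_id|exact: cvg_cst]].
rewrite nbhs_simpl /= => /nbhs_ballP[e e0 eQ].
exists e => // t te; apply: eQ.
by rewrite /ball /= sub0r normrN.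
Qed.

(** Only positive times are controlled, so the derivative is computed as a limit from the right. *)
Lemma diff_ray_le0 f x v : differentiable f x ->
    (exists2 e : R, 0 < e & forall t, 0 < t < e -> f (x + t *: v) <= f x) ->
  'd f x v <= 0.
Proof.
move=> df [e e0 fle]; rewrite -deriveE //.
have dv := diff_derivable (v := v) df.
rewrite ['D_v f x]cvg_at_rightE //; apply: limr_le.
  rewrite -(cvg_at_rightE (fun h : R => h^-1 *: ((f \o shift x) _ - f x))) //.
  apply: cvg_trans dv; apply: cvg_app.
  by move=> A [d d0 Ad]; exists d => // t td t0; apply: Ad => //; exact/lt0r_neq0.
near=> h; apply: mulr_ge0_le0.
  by rewrite invr_ge0; apply: ltW; near: h; exists 1 => /=.
rewrite subr_le0 /= addrC; apply: fle; near: h.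
exists e => // t /=; rewrite sub0r normrN => te t0; rewrite t0 /=.
exact: le_lt_trans (ler_norm _) te.
Unshelve. all: by end_near. Qed.

(** Evenness makes the derivatives along [v] and [- v] equal, while linearity makes them
    opposite. *)
Lemma diff_even f x v : differentiable f x ->
  (forall t : R, f (x + t *: v) = f (x - t *: v)) -> 'd f x v = 0.
Proof.
move=> df ev; suff e : 'd f x v = - 'd f x v by lra.
rewrite -linearN -(deriveE v df) -(deriveE (- v) df) /derive.
rewrite (_ : (fun h => _) = (fun h => h^-1 *: ((f \o shift x) (h *: - v) - f x))) //.
by apply/funext => t /=; rewrite ![_ + x]addrC ev scalerN.
Qed.

End DirectionalDerivatives.

(** * Covariances of a determinantal point process *)

Section Covariance.
Context {R : realType} {N : nat}.
Implicit Types (L M : 'M[R]_N) (J A : {set 'I_N}).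

Lemma proj_set1 (i : 'I_N) :
  proj [set i] = delta_mx i 0 *m (delta_mx i 0 : 'cV[R]_N)^T.
Proof.
apply/matrixP => j k; rewrite projE !mxE big_ord1 !mxE !eqxx !andbT inE.
by rewrite -natrM mulnb; case: (eqVneq j i) => [->|]; rewrite ?andbF //= eq_sym ?andbT.
Qed.

Lemma det_principal1 M i : \det (principal M [set i]) = M i i.
Proof.
rewrite det_principal proj_set1 -mulmxA det1D_mulmxC det_mx11.
rewrite -[RHS](bil_delta M) mulmxBr mulmxBl mulmx1 /bil.
by rewrite trmx_delta mul_delta_mx [delta_mx _ _ in X in _ + (_ - X)]mx11_scalar
  !mxE !eqxx addrCA subrr addr0.
Qed.

Lemma det_mx22 (B : 'M[R]_2) : \det B = B 0 0 * B 1 1 - B 0 1 * B 1 0.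
Proof.
rewrite (expand_det_row _ 0) !big_ord_recl big_ord0 addr0 /cofactor !det_mx11 !mxE.
rewrite /= !expr1 expr0 mul1r mulN1r mulrN.
by congr (_ * B _ _ - B _ _ * B _ _); apply/val_inj.
Qed.

(** The increasing enumeration of [[set i; j]] depends on which index is smaller. The matrix [U]
    selects [i] and then [j]; it has the same projection, so [det_principal] gives the same
    determinant. *)
Lemma det_principal2x2 M i j : i != j ->
  \det (principal M [set i; j]) = M i i * M j j - M i j * M j i.
Proof.
move=> ij; pose f (s : 'I_2) := if s == 0 then i else j.
pose U : 'M[R]_(2, N) := rowsub f 1%:M.
have UE B : U *m B *m U^T = mxsub f f B.
  apply/matrixP => r s; rewrite mul_rowsub_mx mul1mx !mxE.
  rewrite (bigD1 (f s)) //= !mxE eqxx mulr1 big1 ?addr0 // => k ks.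
  by rewrite !mxE eq_sym (negbTE ks) mulr0.
have fI : injective f.
  move=> [[|[|//]] r] [[|[|//]] s]; rewrite /f /= => e; apply/val_inj => //=.
    by rewrite e eqxx in ij.
  by rewrite e eqxx in ij.
have UU : U *m U^T = 1%:M.
  rewrite -[U in U *m _]mulmx1 UE; apply/matrixP => r s.
  by rewrite !mxE (inj_eq fI).
have UJ : U^T *m U = proj [set i; j].
  apply/matrixP => r s; rewrite !mxE !big_ord_recl big_ord0 addr0 !mxE !inE /f /=.
  have [<-|ir] := eqVneq i r.
    by rewrite [j == i]eq_sym (negbTE ij) mul0r addr0 mul1r.
  rewrite mul0r add0r; have [<-|jr] := eqVneq j r; first by rewrite mul1r.
  by rewrite mul0r mul0rn.
rewrite det_principal -UJ -mulmxA det1D_mulmxC mulmxBr mulmxBl mulmx1 UU.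
by rewrite addrCA subrr addr0 UE det_mx22 !mxE.
Qed.

(** The three probabilities are principal minors of [invmx (1%:M + L)]: the diagonal products
    cancel, and symmetry turns the remaining product into a square. *)
Lemma covariance_mem L i j : spd L -> i != j ->
  \sum_(J : {set 'I_N} | (i \notin J) && (j \notin J)) dpp_prob L J
  - (\sum_(J : {set 'I_N} | i \notin J) dpp_prob L J)
    * (\sum_(J : {set 'I_N} | j \notin J) dpp_prob L J)
  = - invmx (1%:M + L) i j ^+ 2.
Proof.
move=> pL ij; have u1 := spd_unitmx (spd1D pL).
have s1 k : \sum_(J : {set 'I_N} | k \notin J) dpp_prob L J = invmx (1%:M + L) k k.
  rewrite -det_principal1 -sum_dpp_disjoint //; apply: eq_bigl => J.
  by rewrite disjoint_sym disjoints1.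
have -> : \sum_(J : {set 'I_N} | (i \notin J) && (j \notin J)) dpp_prob L J =
    \det (principal (invmx (1%:M + L)) [set i; j]).
  rewrite -sum_dpp_disjoint //; apply: eq_bigl => J.
  by rewrite disjoint_sym finset.disjoints_subset finset.subUset !finset.sub1set !inE.
rewrite !s1 det_principal2x2 // addrAC subrr add0r; congr (- _).
have /symP sW := sym_invmx (spd1D pL).1.
by rewrite -[in X in _ * X]sW mxE expr2.
Qed.

End Covariance.

(** * Directions within and across the blocks *)

Section Decoupling.
Context {R : realType} {N : nat} {K : eqType}.
Variables (c : 'I_N -> K) (Lstar L : 'M[R]_N).
Hypotheses (pLstar : spd Lstar) (pL : spd L) (bL : block_diagonal c L).
Hypothesis block_marginals : forall k (g : {set 'I_N} -> R),
  \sum_J dpp_prob Lstar J * g (J :&: block c k) =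
  \sum_J dpp_prob L J * g (J :&: block c k).
Implicit Types (J : {set 'I_N}) (u w : 'cV[R]_N) (k l : K).

(** For such [M] each logarithm splits into terms depending on [J] through a single block, where the
    two laws have equal marginals. *)
Lemma Phi_block M : spd M -> block_diagonal c M -> Phi Lstar M = Phi L M.
Proof.
move=> pM bM; rewrite /Phi; congr (_ - _).
have lnE J := @ln_det_principal_seq R N K c M J (undup (codom c)) pM bM (undup_uniq _).
have h J i : i \in J -> c i \in undup (codom c) by rewrite mem_undup codom_f.
under eq_bigr => J _ do rewrite (lnE J (h J)) mulr_sumr.
under [RHS]eq_bigr => J _ do rewrite (lnE J (h J)) mulr_sumr.
rewrite exchange_big [RHS]exchange_big /=; apply: eq_bigr => k _.
exact: (block_marginals k (fun A => ln (\det (principal M A)))).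
Qed.

Lemma proj_block_delta i :
  proj (block c (c i)) *m delta_mx i 0 = delta_mx i 0 :> 'cV[R]_N.
Proof.
apply/matrixP => j l; rewrite proj_mulmxE !mxE inE.
by have [->|] := eqVneq j i; rewrite ?eqxx ?mul1r // mulr0.
Qed.

Section CrossDirection.
Variables (k l : K) (u w : 'cV[R]_N).
Hypotheses (kl : k != l).
Hypotheses (uk : proj (block c k) *m u = u) (wl : proj (block c l) *m w = w).

Let x J := bil (pinv L J) u u.
Let y J := bil (pinv L J) w w.
Let alpha := bil (invmx (1%:M + L)) u u.
Let beta := bil (invmx (1%:M + L)) w w.
Let H := u *m w^T + w *m u^T.

Lemma det_principal_cross J t :
  \det (principal (L + t *: H) J) = \det (principal L J) * (1 - t ^+ 2 * (x J * y J)).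
Proof.
rewrite principal_outer det_rank2_update ?spd_unitmx ?bil_pinv //.
- exact: spd_principal.
- exact (bil_cross (block_diagonal_pinv J pL bL) kl uk wl).
- have lk : l != k by rewrite eq_sym.
  exact (bil_cross (block_diagonal_pinv J pL bL) lk wl uk).
Qed.

Lemma inv1D_cross : bil (invmx (1%:M + L)) u w = 0 /\ bil (invmx (1%:M + L)) w u = 0.
Proof.
have p1L := spd1D pL.
have b1L := block_diagonalD (@block_diagonal1 R N K c) bL.
have bW := block_diagonal_invmx (spd_unitmx p1L) b1L.
have uw := bil_cross bW kl uk wl.
by split=> //; rewrite bilC //; exact: sym_invmx p1L.1.
Qed.

Lemma det1D_cross t :
  \det (1%:M + (L + t *: H)) = \det (1%:M + L) * (1 - t ^+ 2 * (alpha * beta)).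
Proof.
have [uw wu] := inv1D_cross.
by rewrite addrA det_rank2_update ?spd_unitmx //; exact: spd1D.
Qed.

Lemma Phi_cross_even t : Phi Lstar (L + t *: H) = Phi Lstar (L - t *: H).
Proof.
rewrite /Phi -scaleNr !det1D_cross sqrrN; congr (_ - _).
by apply: eq_bigr => J _; rewrite !det_principal_cross sqrrN.
Qed.

(** Each form depends on one block only, so its mean under [Lstar] is its mean under [L], where
    [sum_dpp_pinv] evaluates it. *)
Lemma sum_cross_marginals :
  \sum_J dpp_prob Lstar J * x J = alpha /\ \sum_J dpp_prob Lstar J * y J = beta.
Proof.
split; rewrite ?/alpha ?/beta -sum_dpp_pinv //.
  under eq_bigr => J _ do rewrite /x (bil_pinv_block J pL bL uk).
  under [RHS]eq_bigr => J _ do rewrite (bil_pinv_block J pL bL uk).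
  exact: (block_marginals k (fun A => bil (pinv L A) u u)).
under eq_bigr => J _ do rewrite /y (bil_pinv_block J pL bL wl).
under [RHS]eq_bigr => J _ do rewrite (bil_pinv_block J pL bL wl).
exact: (block_marginals l (fun A => bil (pinv L A) w w)).
Qed.

Lemma bil_pinv_ge0 J v : 0 <= bil (pinv L J) v v.
Proof.
by rewrite -bil_pinv; apply/bil_invmx_ge0/spd_principal.
Qed.

(** The increment of [Phi Lstar] along [H] is at least [t ^+ 2] times the difference of the two
    sides, up to an explicit error of order [t ^+ 4]; at a local maximum it is nonpositive. *)
Lemma local_max_cross : local_max (Phi Lstar) L ->
  alpha * beta <= \sum_J dpp_prob Lstar J * (x J * y J).
Proof.
move=> /(near_ray H)[e e0 eP].
have xy0 J : 0 <= x J * y J by rewrite mulr_ge0 ?bil_pinv_ge0.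
pose a := bil (invmx L) u u + bil (invmx L) w w.
pose Z := \sum_J x J * y J.
have Z0 : 0 <= Z by rewrite sumr_ge0.
have ZJ J : x J * y J <= Z.
  by rewrite /Z (bigD1 J) //= lerDl sumr_ge0.
pose S2 := \sum_J dpp_prob Lstar J * (x J * y J) ^+ 2.
have S20 : 0 <= S2.
  by rewrite sumr_ge0 // => J _; rewrite mulr_ge0 ?sqr_ge0 // ltW ?dpp_prob_gt0.
have a0 : 0 <= a by rewrite addr_ge0 ?bil_invmx_ge0.
(* Below [d], the perturbed kernel stays in the neighbourhood of the local maximum, is positive
   definite by [spd_perturb], and satisfies [t ^+ 2 * (x J * y J) <= 1 / 2] as [ln1B_ge] requires.
   The added 1 keeps the denominators positive. *)
pose d := Num.min e (Num.min (1 / (1 + a)) (1 / (1 + 2 * Z))).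
have d0 : 0 < d by rewrite !lt_min e0 !divr_gt0 //; lra.
have key t : 0 < t < d ->
    alpha * beta <= \sum_J dpp_prob Lstar J * (x J * y J) + 2 * t * S2.
  rewrite !lt_min => /andP[t0 /andP[te /andP[ta tZ]]].
  have tn : `|t| = t by rewrite gtr0_norm.
  have ta1 : t * (1 + a) < 1 by move: ta; rewrite ltr_pdivlMr //; lra.
  have tZ1 : t * (1 + 2 * Z) < 1 by move: tZ; rewrite ltr_pdivlMr //; lra.
  have pM : spd (L + t *: H) by apply: spd_perturb => //; rewrite tn -/a; lra.
  have := eP t; rewrite tn => /(_ te pM).
  have t1 : t < 1 by nra.
  have tt : t ^+ 2 <= t by rewrite expr2 ger_pMr // ltW.
  have posJ J : 0 < 1 - t ^+ 2 * (x J * y J).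
    by have := det_principal_gt0 J pM; rewrite det_principal_cross pmulr_rgt0 // det_principal_gt0.
  have pos1 : 0 < 1 - t ^+ 2 * (alpha * beta).
    have := spd_det_gt0 (spd1D pM); rewrite det1D_cross pmulr_rgt0 //.
    exact/spd_det_gt0/spd1D.
  rewrite /Phi det1D_cross lnM ?posrE ?(spd_det_gt0 (spd1D pL)) //.
  under eq_bigr => J _ do
    rewrite det_principal_cross lnM ?posrE ?det_principal_gt0 // mulrDr.
  rewrite big_split /=.
  have h1 : ln (1 - t ^+ 2 * (alpha * beta)) <= - (t ^+ 2 * (alpha * beta)).
    by apply: le_trans (ln_le_subr1 pos1) _; lra.
  have h2 : - (t ^+ 2 * \sum_J dpp_prob Lstar J * (x J * y J))
      - 2 * t ^+ 4 * S2 <=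
      \sum_J dpp_prob Lstar J * ln (1 - t ^+ 2 * (x J * y J)).
    rewrite /S2 !mulr_sumr -opprD -big_split -sumrN /=.
    apply: ler_sum => J _.
    have zJ : 0 <= t ^+ 2 * (x J * y J) <= 1 / 2.
      rewrite mulr_ge0 ?sqr_ge0 //=.
      have := ler_pM (sqr_ge0 t) (xy0 J) tt (ZJ J); lra.
    have := ler_wpM2l (ltW (dpp_prob_gt0 J pLstar)) (ln1B_ge zJ).
    apply: le_trans; rewrite le_eqVlt; apply/orP/or_introl/eqP; ring.
  move=> h3.
  have h4 : t ^+ 2 * (alpha * beta) <=
      t ^+ 2 * (\sum_J dpp_prob Lstar J * (x J * y J) + 2 * t ^+ 2 * S2).
    rewrite mulrDr; have -> : t ^+ 2 * (2 * t ^+ 2 * S2) = 2 * t ^+ 4 * S2 by ring.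
    lra.
  move: h4; rewrite ler_pM2l ?exprn_gt0 // => /le_trans; apply.
  by rewrite lerD2l ler_wpM2r // ler_pM2l.
apply/ler_addgt0Pr => eps eps0.
(* This choice makes the error [2 * t * S2] at most [eps], and [d / 2] keeps [t] strictly below
   [d]. *)
pose t := Num.min (d / 2) (eps / (2 * (1 + S2))).
have t0 : 0 < t by rewrite lt_min !divr_gt0 // mulr_gt0 //; lra.
apply: le_trans (key t _) _.
  by rewrite t0 /= gt_min; apply/orP; left; lra.
rewrite lerD2l.
have : t <= eps / (2 * (1 + S2)) by rewrite ge_min lexx orbT.
rewrite ler_pdivlMr; last by rewrite mulr_gt0 //; lra.
lra.
Qed.

End CrossDirection.

Local Notation ev i := (delta_mx i 0 : 'cV[R]_N).

Lemma spd_sym_direction i j : exists2 e : R, 0 < e & forall t, `|t| < e ->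
  spd (L + t *: (ev i *m (ev j)^T + ev j *m (ev i)^T)).
Proof.
pose a := bil (invmx L) (ev i) (ev i)
  + bil (invmx L) (ev j) (ev j).
have a0 : 0 <= a by rewrite addr_ge0 ?bil_invmx_ge0.
exists (1 / (1 + a)); first by rewrite divr_gt0 //; lra.
move=> t; rewrite ltr_pdivlMr; last lra.
move=> ht; apply: spd_perturb => //; rewrite -/a.
by apply: le_lt_trans ht; rewrite ler_wpM2l //; lra.
Qed.

(** By linearity it is enough to treat the symmetrized elementary matrices [S i j]: evenness settles
    those across blocks, Gibbs' inequality those within a block. *)
Lemma critical_point_Phi : critical_point (Phi Lstar) L.
Proof.
have dPhi := differentiable_Phi Lstar pL; split=> // H /symP sH.
pose S i j : 'M[R]_N :=
  ev i *m (ev j)^T + ev j *m (ev i)^T.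
have SE i j : S i j = delta_mx i j + delta_mx j i.
  by rewrite /S !trmx_delta !mul_delta_mx.
(* The double sum meets each unordered pair twice, and [S i i] is twice a diagonal unit; hence the
   division by 2. *)
have -> : H = \sum_i \sum_j (H i j / 2) *: S i j.
  rewrite [LHS](_ : _ = 2^-1 *: (H + H^T)); last first.
    by apply/matrixP => i j; rewrite sH 2!mxE; field.
  rewrite {1 2}[H]matrix_sum_delta linear_sum /= -big_split scaler_sumr /=.
  apply: eq_bigr => i _; rewrite linear_sum -big_split scaler_sumr /=.
  apply: eq_bigr => j _; rewrite [(_ *: _)^T]linearZ /= trmx_delta -scalerDr scalerA SE.
  by rewrite mulrC.
have dS i j : 'd (Phi Lstar) L (S i j) = 0.
  have [cij|cij] := eqVneq (c i) (c j); last first.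
    apply: diff_even => // t.
    exact: (Phi_cross_even cij (proj_block_delta i) (proj_block_delta j)).
  have [e e0 pe] := spd_sym_direction i j.
  have bS : block_diagonal c (S i j).
    have pj := proj_block_delta j; rewrite -cij in pj.
    have pi := proj_block_delta i.
    by apply: block_diagonalD; [exact: block_diagonal_outer pi pj
      |exact: block_diagonal_outer pj pi].
  have le t : `|t| < e -> Phi Lstar (L + t *: S i j) <= Phi Lstar L.
    move=> te; have pM := pe t te.
    have bM : block_diagonal c (L + t *: S i j).
      by apply: block_diagonalD => //; exact: block_diagonalZ.
    by rewrite !Phi_block // Phi_le.
  (* The rays for positive and negative [t] bound the differential from both sides. *)
  apply/eqP; rewrite eq_le; apply/andP; split.
    apply: diff_ray_le0 => //; exists e => // t /andP[t0 te].
    by apply: le; rewrite gtr0_norm.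
  rewrite -oppr_le0 -linearN.
  apply: diff_ray_le0 => //; exists e => // t /andP[t0 te].
  by rewrite scalerN -scaleNr; apply: le; rewrite normrN gtr0_norm.
rewrite linear_sum big1 // => i _; rewrite linear_sum big1 // => j _.
by rewrite linearZ /= dS scaler0.
Qed.

(** By Gibbs' inequality a local minimum would give [L] and [(1 + t) *: L] the same law. The ratio
    of the probabilities of [[set i]] and of the empty set recovers the entry at [i], which scaling
    changes. *)
Lemma not_local_min_Phi (i : 'I_N) : ~ local_min (Phi Lstar) L.
Proof.
move=> /(near_ray L)[e e0 eP].
pose t := Num.min (e / 2) 1.
have t0 : 0 < t by rewrite lt_min ltr01 andbT; lra.
have te : `|t| < e by rewrite gtr0_norm // gt_min; apply/orP; left; lra.
have ME : L + t *: L = (1 + t) *: L by rewrite scalerDl scale1r.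
have pM : spd (L + t *: L) by rewrite ME; apply: spdZ => //; lra.
have bM : block_diagonal c (L + t *: L).
  by apply: block_diagonalD => //; exact: block_diagonalZ.
have := eP t te pM; rewrite !Phi_block // => ge.
have /Phi_eq : Phi L (L + t *: L) = Phi L L.
  by apply/eqP; rewrite eq_le ge Phi_le.
move=> /(_ pL pM) e1.
have ratio (M : 'M[R]_N) : spd M -> dpp_prob M [set i] / dpp_prob M finset.set0 = M i i.
  move=> pM'; have d0 := spd_det_gt0 (spd1D pM').
  by rewrite /dpp_prob det_principal1 det_principal0; field; rewrite lt0r_neq0.
have := ratio _ pM; rewrite !e1 ratio // !mxE.
have : 0 < L i i.
  rewrite -(bil_delta L); apply: spd_bil_gt0 => //.
  by apply/negP => /eqP/matrixP/(_ i 0); rewrite !mxE !eqxx => /eqP; rewrite oner_eq0.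
by move=> Lii; have : 0 < t * L i i by [rewrite mulr_gt0]; lra.
Qed.

End Decoupling.

(** * Bilinearity of covariance and numbers of points *)

Section FiniteCovariance.
Context {R : realType} {T : finType}.
Implicit Types (p f g : T -> R).

Definition cov p f g : R :=
  \sum_t p t * (f t * g t) - (\sum_t p t * f t) * (\sum_t p t * g t).

Lemma covC p f g : cov p f g = cov p g f.
Proof.
rewrite /cov [X in _ - X]mulrC; congr (_ - _).
by apply: eq_bigr => t _; rewrite [f t * _]mulrC.
Qed.

Lemma covDl p f f' g : cov p (fun t => f t + f' t) g = cov p f g + cov p f' g.
Proof.
rewrite /cov; under eq_bigr => t _ do rewrite mulrDl mulrDr.
under [X in _ - X * _]eq_bigr => t _ do rewrite mulrDr.
by rewrite !big_split /=; ring.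
Qed.

Lemma cov_suml p (I : finType) (A : {pred I}) (f : I -> T -> R) g :
  cov p (fun t => \sum_(i in A) f i t) g = \sum_(i in A) cov p (f i) g.
Proof.
rewrite /cov; under eq_bigr => t _ do rewrite mulr_suml mulr_sumr.
rewrite exchange_big sumrB /=; congr (_ - _); rewrite -mulr_suml; congr (_ * _).
by under eq_bigr => t _ do rewrite mulr_sumr; rewrite exchange_big.
Qed.

Lemma cov1B p f g : \sum_t p t = 1 ->
  cov p (fun t => 1 - f t) (fun t => 1 - g t) = cov p f g.
Proof.
move=> p1; have E h : \sum_t p t * (1 - h t) = 1 - \sum_t p t * h t.
  by under eq_bigr => t _ do rewrite mulrBr mulr1; rewrite sumrB p1.
rewrite /cov !E; have -> : \sum_t p t * ((1 - f t) * (1 - g t)) =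
    1 - \sum_t p t * f t - \sum_t p t * g t + \sum_t p t * (f t * g t).
  transitivity (\sum_t (p t - p t * f t - p t * g t + p t * (f t * g t))).
    by apply: eq_bigr => t _; ring.
  by rewrite big_split /= !sumrB p1.
ring.
Qed.

End FiniteCovariance.

Section CovarianceCard.
Context {R : realType} {N : nat}.
Implicit Types (L : 'M[R]_N) (A B J : {set 'I_N}).

Lemma cardI_sum J A : #|J :&: A|%:R = \sum_(i in A) (i \in J)%:R :> R.
Proof.
rewrite -sum1_card natr_sum [RHS]big_mkcond [LHS]big_mkcond /=.
by apply: eq_bigr => i _; rewrite inE; case: (i \in J); case: (i \in A).
Qed.

Lemma cov_dpp_mem L i j : spd L -> i != j ->
  cov (dpp_prob L) (fun J => (i \in J)%:R) (fun J => (j \in J)%:R) =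
  - invmx (1%:M + L) i j ^+ 2.
Proof.
move=> pL ij; rewrite -covariance_mem // -cov1B ?sum_dpp_prob // /cov.
have E (P : pred {set 'I_N}) :
    \sum_(J | P J) dpp_prob L J = \sum_J dpp_prob L J * (P J)%:R.
  rewrite big_mkcond; apply: eq_bigr => J _.
  by case: (P J); rewrite ?mulr1 ?mulr0.
have B (b : bool) : 1 - b%:R = (~~ b)%:R :> R by case: b; rewrite ?subrr ?subr0.
rewrite !E; congr (_ - _ * _); apply: eq_bigr => J _; rewrite !B //.
by rewrite -natrM mulnb.
Qed.

Lemma cov_dpp_card L A B : spd L -> [disjoint A & B] ->
  cov (dpp_prob L) (fun J => #|J :&: A|%:R) (fun J => #|J :&: B|%:R) =
  - \sum_(i in A) \sum_(j in B) invmx (1%:M + L) i j ^+ 2.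
Proof.
move=> pL dAB.
rewrite (_ : (fun J => _) = (fun J => \sum_(i in A) (i \in J)%:R)); last first.
  by apply/funext => J; rewrite cardI_sum.
rewrite [X in cov _ _ X](_ : _ = (fun J => \sum_(i in B) (i \in J)%:R)); last first.
  by apply/funext => J; rewrite cardI_sum.
rewrite cov_suml -sumrN; apply: eq_bigr => i iA.
rewrite covC cov_suml -sumrN; apply: eq_bigr => j jB.
rewrite covC cov_dpp_mem //; apply: contraTneq iA => ->.
by rewrite (disjointFl dAB jB).
Qed.

Lemma block_diagonal_inv1D (K : eqType) (c : 'I_N -> K) L : spd L ->
  block_diagonal c (invmx (1%:M + L)) -> block_diagonal c L.
Proof.
move=> pL bW; have p1L := spd1D pL.
have b1L : block_diagonal c (1%:M + L).
  rewrite -[1%:M + L]invmxK; apply: block_diagonal_invmx => //.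
  by rewrite unitmx_inv spd_unitmx.
move=> i j ij; have := b1L i j ij; rewrite mxE (block_diagonal1 ij).
by rewrite add0r.
Qed.

(** The covariance is minus the square of an entry of [invmx (1%:M + L)], so it vanishes only with
    that entry. *)
Lemma block_diagonal_uncorrelated (K : eqType) (c : 'I_N -> K) L : spd L ->
    (forall i j, c i != c j ->
      \sum_(J : {set 'I_N} | (i \notin J) && (j \notin J)) dpp_prob L J =
      (\sum_(J : {set 'I_N} | i \notin J) dpp_prob L J)
      * (\sum_(J : {set 'I_N} | j \notin J) dpp_prob L J)) ->
  block_diagonal c L.
Proof.
move=> pL h; apply: block_diagonal_inv1D => // i j cij.
have ij : i != j by apply: contraNneq cij => ->.
have := covariance_mem pL ij; rewrite h // subrr => /esym/eqP.
by rewrite oppr_eq0 sqrf_eq0 => /eqP.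
Qed.

End CovarianceCard.

(** * Consequences of a local maximum *)

Section LocalMax.
Context {R : realType} {N : nat} {K : eqType}.
Variables (c : 'I_N -> K) (Lstar L : 'M[R]_N).
Hypotheses (pLstar : spd Lstar) (pL : spd L) (bL : block_diagonal c L).
Hypothesis block_marginals : forall k (g : {set 'I_N} -> R),
  \sum_J dpp_prob Lstar J * g (J :&: block c k) =
  \sum_J dpp_prob L J * g (J :&: block c k).

(** The second-order condition concerns rank-one matrices. The covariance is additive in each matrix
    argument, so [spd_additive_ge0], used once per argument, replaces both by [L]. *)
Lemma local_max_cov_card k l : local_max (Phi Lstar) L -> k != l ->
  0 <= cov (dpp_prob Lstar) (fun J => #|J :&: block c k|%:R)
                            (fun J => #|J :&: block c l|%:R).
Proof.
move=> lm kl.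
(* A functional additive in [G]: at [u *m u^T] it is the form of [pinv L J] at the component of [u]
   in block [k], and at [L] it counts the points of [J] in that block. *)
pose X k (G : 'M[R]_N) J :=
  \tr (pinv L J *m (proj (block c k) *m G *m proj (block c k))).
have XD k' G G' J : X k' (G + G') J = X k' G J + X k' G' J.
  by rewrite /X mulmxDr mulmxDl mulmxDr mxtraceD.
have Xu k' (u : 'cV[R]_N) J : X k' (u *m u^T) J =
    bil (pinv L J) (proj (block c k') *m u) (proj (block c k') *m u).
  by rewrite -mxtrace_outer trmx_mul tr_proj /X !mulmxA.
have XL k' J : X k' L J = #|J :&: block c k'|%:R by exact: mxtrace_pinv.
have Pid k' (u : 'cV[R]_N) :
    proj (block c k') *m (proj (block c k') *m u) = proj (block c k') *m u.
  by rewrite mulmxA projI finset.setIid.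
have F1 (u w : 'cV[R]_N) : 0 <= cov (dpp_prob Lstar) (X k (u *m u^T)) (X l (w *m w^T)).
  have := local_max_cross pLstar pL bL kl (Pid k u) (Pid l w) lm.
  have [<- <-] := sum_cross_marginals pL bL block_marginals (Pid k u) (Pid l w).
  rewrite -subr_ge0 /cov => /le_trans; apply; rewrite le_eqVlt.
  apply/orP/or_introl/eqP; congr (_ - _ * _); apply: eq_bigr => J _; rewrite ?Xu //.
have F2 (w : 'cV[R]_N) : 0 <= cov (dpp_prob Lstar) (X k L) (X l (w *m w^T)).
  apply: (@spd_additive_ge0 _ _
    (fun G => cov (dpp_prob Lstar) (X k G) (X l (w *m w^T)))) => // G G'.
  by rewrite -covDl; congr cov; apply/funext => J; rewrite XD.
have : 0 <= cov (dpp_prob Lstar) (X k L) (X l L).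
  apply: (@spd_additive_ge0 _ _
    (fun G => cov (dpp_prob Lstar) (X k L) (X l G))) => // G G'.
  rewrite covC [cov _ _ (X l G)]covC [cov _ _ (X l G')]covC -covDl.
  by congr cov; apply/funext => J; rewrite XD.
congr (0 <= cov _ _ _); apply/funext => J; exact: XL.
Qed.

(** A nonnegative covariance that equals minus a sum of squares makes every square vanish, so
    [Lstar] is block diagonal too. *)
Lemma local_max_dpp_prob : local_max (Phi Lstar) L ->
  forall J, dpp_prob Lstar J = dpp_prob L J.
Proof.
move=> lm; have bLstar : block_diagonal c Lstar.
  apply: block_diagonal_inv1D => // i j cij.
  have := local_max_cov_card lm cij; rewrite cov_dpp_card //; last first.
    rewrite finset.disjoints_subset; apply/fintype.subsetP => k.
    by rewrite !inE => /eqP ->.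
  rewrite oppr_ge0 => le0.
  have ge0 a b : 0 <= invmx (1%:M + Lstar) a b ^+ 2 by exact: sqr_ge0.
  have : \sum_(a in block c (c i)) \sum_(b in block c (c j))
      invmx (1%:M + Lstar) a b ^+ 2 == 0.
    by rewrite eq_le le0 sumr_ge0 // => a _; rewrite sumr_ge0.
  rewrite psumr_eq0; last by move=> a _; rewrite sumr_ge0.
  move=> /allP/(_ i (mem_index_enum i)); rewrite inE eqxx /=.
  rewrite psumr_eq0 //; move=> /allP/(_ j (mem_index_enum j)).
  by rewrite inE eqxx /= sqrf_eq0 => /eqP.
apply: Phi_eq => //; apply/eqP; rewrite eq_le Phi_le //=.
(* At both block diagonal kernels [Phi L] may be replaced by [Phi Lstar]; the reverse inequality is
   then Gibbs' inequality for [Lstar]. *)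
rewrite -(Phi_block block_marginals pL bL).
rewrite -(Phi_block block_marginals pLstar bLstar).
exact: Phi_le.
Qed.

Lemma saddle_point_Phi :
  (exists J, dpp_prob Lstar J != dpp_prob L J) -> saddle_point (Phi Lstar) L.
Proof.
move=> [J neq]; split; first exact: critical_point_Phi pL bL block_marginals.
  by move=> /local_max_dpp_prob e; rewrite e eqxx in neq.
(* On an empty ground set there is only one matrix, so the laws could not differ. *)
have [i _|no_i] := pickP (@predT 'I_N).
  exact: (not_local_min_Phi pL bL block_marginals i).
have e : Lstar = L by apply/matrixP => i; have := no_i i.
by rewrite e eqxx in neq.
Qed.

End LocalMax.

(** * Random sets *)

Section RandomSets.
Local Open Scope classical_set_scope.
Context {R : realType} {N : nat} {d : measure_display} {T : measurableType d}.
Variables (P : probability T R) (Z : {RV P >-> {set 'I_N}}) (L : 'M[R]_N).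
Hypothesis hZ : has_dpp_kernel Z L.

Lemma prob_dpp_seq (s : seq {set 'I_N}) : uniq s ->
  P (Z @^-1` [set` s]) = (\sum_(J <- s) dpp_prob L J)%:E.
Proof.
have mZ (A : set {set 'I_N}) : measurable (Z @^-1` A).
  by rewrite -[_ @^-1` _]setTI; exact: measurable_funPT.
elim: s => [|J s IH] /=; first by rewrite big_nil set_nil preimage_set0 measure0.
move=> /andP[Js us].
have -> : [set` J :: s] = [set J] `|` [set` s].
  by apply/seteqP; split=> A /=; rewrite inE; [case/predU1P=> [->|]; [left|right]
    |case=> [->|->]; rewrite ?eqxx ?orbT].
rewrite preimage_setU measureU //.
  by rewrite big_cons EFinD -IH //; congr (_ + _)%E; exact: hZ.2.
by apply/seteqP; split=> // w /= [-> /=]; rewrite (negbTE Js).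
Qed.

Lemma prob_dpp (E : pred {set 'I_N}) :
  P (Z @^-1` [set J : {set 'I_N} | E J]) = (\sum_(J | E J) dpp_prob L J)%:E.
Proof.
rewrite -big_enum -prob_dpp_seq ?enum_uniq //; congr (P (_ @^-1` _)).
by apply/seteqP; split=> J /=; rewrite mem_enum.
Qed.

End RandomSets.

(** * Partial decouplings in terms of kernels *)

Section PartialDecoupling.
Local Open Scope classical_set_scope.
Context {R : realType} {N : nat} {d d' : measure_display}.
Context {T : measurableType d} {T' : measurableType d'}.
Variables (P : probability T R) (Z : {RV P >-> {set 'I_N}}).
Variables (P' : probability T' R) (Z' : {RV P' >-> {set 'I_N}}).
Variables (Lstar L : 'M[R]_N) (PP : {set {set 'I_N}}).
Hypotheses (hZ : has_dpp_kernel Z Lstar) (hL : has_dpp_kernel Z' L).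
Hypothesis hPP : finset.partition PP [set: 'I_N]%SET.

Lemma pblock_in_partition i : finset.pblock PP i \in PP.
Proof. by rewrite finset.pblock_mem // (finset.cover_partition hPP) finset.in_setT. Qed.

Lemma mem_pblock_partition i : i \in finset.pblock PP i.
Proof. by rewrite finset.mem_pblock (finset.cover_partition hPP) finset.in_setT. Qed.

Lemma block_pblock b : b \in PP -> block (finset.pblock PP) b = b.
Proof.
move=> bPP; have tPP := partition_trivIset hPP.
apply/finset.setP => i; rewrite inE; apply/eqP/idP => [<-|ib].
  exact: mem_pblock_partition.
exact: finset.def_pblock tPP bPP ib.
Qed.

Lemma decoupling_marginals : partial_decoupling PP Z Z' ->
  forall b (g : {set 'I_N} -> R),
  \sum_J dpp_prob Lstar J * g (J :&: block (finset.pblock PP) b) =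
  \sum_J dpp_prob L J * g (J :&: block (finset.pblock PP) b).
Proof.
(* Labels are arbitrary subsets. One outside [PP] has an empty block, and both sides are then the
   total mass times the value of [g] at the empty set. *)
move=> [_ law] b g; have [bPP|bPP] := boolP (b \in PP); last first.
  have -> : block (finset.pblock PP) b = finset.set0.
    apply/finset.setP => i; rewrite !inE; apply: contraNF bPP => /eqP <-.
    exact: pblock_in_partition.
  under eq_bigr => J _ do rewrite finset.setI0.
  under [RHS]eq_bigr => J _ do rewrite finset.setI0.
  by rewrite -[LHS]mulr_suml -[RHS]mulr_suml (sum_dpp_prob hZ.1) (sum_dpp_prob hL.1).
rewrite block_pblock //.
have marg A : \sum_(J | J :&: b == A) dpp_prob Lstar J =
    \sum_(J | J :&: b == A) dpp_prob L J.
  apply: EFin_inj.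
  rewrite -(prob_dpp hZ [pred J : {set 'I_N} | J :&: b == A])
    -(prob_dpp hL [pred J : {set 'I_N} | J :&: b == A]).
  have pre (U : Type) (X : U -> {set 'I_N}) :
      X @^-1` [set J : {set 'I_N} | [pred J : {set 'I_N} | J :&: b == A] J] =
      (fun w => X w :&: b) @^-1` [set A].
    by apply/seteqP; split=> w /= /eqP.
  by rewrite !pre; exact: esym (law b bPP [set A] I).
(* Grouping the subsets by their trace on [b] makes [g] constant on each group. *)
rewrite (partition_big (fun J => J :&: b) xpredT) //=.
rewrite [RHS](partition_big (fun J => J :&: b) xpredT) //=.
apply: eq_bigr => A _.
under eq_bigr => J /eqP -> do over.
under [RHS]eq_bigr => J /eqP -> do over.
by rewrite -[LHS]mulr_suml -[RHS]mulr_suml marg.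
Qed.

Lemma decoupling_uncorrelated i j : partial_decoupling PP Z Z' ->
    finset.pblock PP i != finset.pblock PP j ->
  \sum_(J : {set 'I_N} | (i \notin J) && (j \notin J)) dpp_prob L J =
  (\sum_(J : {set 'I_N} | i \notin J) dpp_prob L J)
  * (\sum_(J : {set 'I_N} | j \notin J) dpp_prob L J).
Proof.
move=> [ind _] ij; set bi := finset.pblock PP i in ij *; set bj := finset.pblock PP j in ij *.
have ibi : i \in bi := mem_pblock_partition i.
have jbj : j \in bj := mem_pblock_partition j.
(* As [i] lies in [bi], missing [i] is an event on the trace on [bi]; likewise for [j] and [bj]. *)
pose E b : set {set 'I_N} :=
  if b == bi then [set J : {set 'I_N} | i \notin J]
  else [set J : {set 'I_N} | j \notin J].
have sB : [set bi; bj]%SET \subset PP.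
  by apply/fintype.subsetP => b; rewrite !inE => /orP[]/eqP ->; exact: pblock_in_partition.
have := ind [set bi; bj]%SET E sB (fun _ _ => I).
rewrite big_setU1 ?inE //= big_set1 {2 3}/E eqxx eq_sym (negbTE ij).
have -> : (fun w => Z' w :&: bi) @^-1` [set J : {set 'I_N} | i \notin J] =
    Z' @^-1` [set J : {set 'I_N} | i \notin J].
  by apply/seteqP; split=> w /=; rewrite finset.in_setI ibi andbT.
have -> : (fun w => Z' w :&: bj) @^-1` [set J : {set 'I_N} | j \notin J] =
    Z' @^-1` [set J : {set 'I_N} | j \notin J].
  by apply/seteqP; split=> w /=; rewrite finset.in_setI jbj andbT.
have -> : \bigcap_(b in [set` [set bi; bj]%SET]) (fun w => Z' w :&: b) @^-1` E b =
    Z' @^-1` [set J : {set 'I_N} | (i \notin J) && (j \notin J)].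
  apply/seteqP; split=> w /=.
    move=> h; apply/andP; split.
      have /h : bi \in [set bi; bj]%SET by rewrite !inE eqxx.
      by rewrite /E /= eqxx /= finset.in_setI ibi andbT.
    have /h : bj \in [set bi; bj]%SET by rewrite !inE eqxx orbT.
    by rewrite /E /= eq_sym (negbTE ij) /= finset.in_setI jbj andbT.
  move=> /andP[iZ jZ] b; rewrite /= !inE /E => /orP[]/eqP ->.
    by rewrite eqxx /= inE (negbTE iZ).
  by rewrite eq_sym (negbTE ij) /= inE (negbTE jZ).
rewrite (prob_dpp hL [pred J : {set 'I_N} | i \notin J]).
rewrite (prob_dpp hL [pred J : {set 'I_N} | j \notin J]).
rewrite (prob_dpp hL [pred J : {set 'I_N} | (i \notin J) && (j \notin J)]).
by move=> e; apply: EFin_inj; rewrite EFinM.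
Qed.

Lemma same_law_dpp : (forall J, dpp_prob Lstar J = dpp_prob L J) -> same_law P' Z' P Z.
Proof.
move=> e A _; rewrite /pushforward.
have -> : A = [set J : {set 'I_N} | `[< A J >]] by apply/seteqP; split=> J /= /asboolP.
by rewrite (prob_dpp hZ) (prob_dpp hL); congr EFin; apply: eq_bigr.
Qed.

End PartialDecoupling.

Theorem theorem11 (R : realType) (N : nat) (Lstar : 'M[R]_N)
    (hLstar : spd Lstar)
    (d : measure_display) (T : measurableType d) (P : probability T R)
    (Z : {RV P >-> {set 'I_N}}) (hZ : has_dpp_kernel Z Lstar)
    (PP : {set {set 'I_N}}) (hPP : finset.partition PP [set: 'I_N]%SET)
    (d' : measure_display) (T' : measurableType d') (P' : probability T' R)
    (Z' : {RV P' >-> {set 'I_N}}) (hZ' : partial_decoupling PP Z Z')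
    (L : 'M[R]_N) (hL : has_dpp_kernel Z' L) :
  critical_point (Phi Lstar) L /\
  (strict_partial_decoupling PP Z Z' -> saddle_point (Phi Lstar) L).
Proof.
(* Each index is labelled by the block of [PP] that contains it. *)
have bL : block_diagonal (finset.pblock PP) L.
  apply: (block_diagonal_uncorrelated hL.1) => i j.
  exact: decoupling_uncorrelated hZ'.
have marg := decoupling_marginals hZ hL hPP hZ'.
split; first exact: critical_point_Phi hL.1 bL marg.
move=> [_ strict]; apply: (saddle_point_Phi hLstar hL.1 bL marg).
apply: contrapT => /forallNP same; apply: strict.
by apply: (same_law_dpp hZ hL) => J; apply/eqP/negPn/negP; exact: same.
Qed.
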